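(* Let $T>0$, $\omega_0=\frac{2\pi}{T}$, and let $x(t)$ be a $T$-periodic FRI signal of the form $$x(t) = \sum_{p\in\mathbb{Z}}\sum_{\ell=1}^L a_{\ell}\, h(t-\tau_{\ell}-p T),$$ where $\tau_\ell \in [0, T)$, the amplitudes $a_\ell$ are finite ($|a_\ell|<\infty$), $L$ is known, and the real-valued pulse $h(t)$ is known and absolutely integrable, with $\hat{h}(k\omega_0)\neq 0$ for all $k\in\{-K,\dots,K\}$. Let the sampling kernel $g(t)$ satisfy $$\hat{g}(k\omega_0) = \begin{cases} 1 & \text{if } k\in \{-K,\cdots,K \},\\ 0 & \text{otherwise},\end{cases}$$ and $\max_t|(h*g)(t)|<\infty$. Let $y=x*g$ and $c=\max_t|y(t)|$. Choose real positive IF-TEM parameters $b,\kappa,\delta$ with $c<b<\infty$ and $$\frac{b-c}{\kappa\delta} \geq \frac{2K+2}{T}.$$ Then the parameters $\{a_{\ell}, \tau_{\ell}\}_{\ell=1}^L$ can be perfectly recovered from the IF-TEM outputs (firing instants) if $K \geq L$.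
   Context: Fourier transforms: $\hat{h}(\omega)=\int h(t)e^{-j\omega t}dt$, similarly for $\hat g$. An integrate-and-fire time encoding machine (IF-TEM) with parameters $b,\kappa,\delta>0$ takes as input a real bounded signal $y(t)$ with $|y(t)|\le c<b$ and outputs firing instants $\{t_n\}$ defined recursively: given $t_n$, the next instant $t_{n+1}$ is the first time such that $\frac{1}{\kappa}\int_{t_n}^{t_{n+1}}(y(s)+b)\,ds=\delta$ (the integrator is reset after each firing). The IF-TEM outputs are these firing instants; recovery uses the firing instants within an interval of length $T$ together with the known parameters $b,\kappa,\delta$, the kernel $g$ and the pulse $h$.
   Formalization: The delays are assumed pairwise distinct and the amplitudes nonzero (else a zero amplitude leaves its delay undetermined); g is real and absolutely integrable, x*g converges absolutely; recovery means uniqueness up to relabelling from instants in a length-T window starting at a firing. *)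

(* Defs.v *)
From HB Require Import structures.
From mathcomp Require Import all_boot all_order all_algebra.
From mathcomp Require Import all_classical all_reals all_analysis.
Set Implicit Arguments. Unset Strict Implicit. Unset Printing Implicit Defensive.
Import Order.TTheory GRing.Theory Num.Theory.
Import numFieldNormedType.Exports.
Local Open Scope classical_set_scope.
Local Open Scope ring_scope.

Section IFTEM_defs.
Context {R : realType}.

Definition lebm := @lebesgue_measure R.

Definition abs_integrable (f : R -> R) : Prop :=
  lebm.-integrable setT (EFin \o f).

Definition FT_re (f : R -> R) (w : R) : R :=
  Rintegral lebm setT (fun t => f t * cos (w * t)).
Definition FT_im (f : R -> R) (w : R) : R :=
  - Rintegral lebm setT (fun t => f t * sin (w * t)).
Definition FT_nonzero (f : R -> R) (w : R) : Prop :=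
  ~ (FT_re f w = 0 /\ FT_im f w = 0).
Definition FT_eq_real (f : R -> R) (w v : R) : Prop :=
  FT_re f w = v /\ FT_im f w = 0.

Definition omega0 (T : R) : R := 2 * pi / T.

Definition convol (f g : R -> R) (t : R) : R :=
  Rintegral lebm setT (fun s => f s * g (t - s)).
Definition conv_defined (f g : R -> R) : Prop :=
  forall t, lebm.-integrable setT (EFin \o (fun s => f s * g (t - s))).

Definition FRI_params (T : R) (L : nat) (a tau : 'I_L -> R) : Prop :=
  (forall l, 0 <= tau l < T) /\ injective tau /\ (forall l, a l != 0).

(* x(t) = \sum_{p in Z} \sum_{l=1}^L a_l h(t - tau_l - p T),
   the sum over p in Z being the limit of the symmetric partial sums |p| <= N *)
Definition FRI_signal (T : R) (L : nat) (h : R -> R) (a tau : 'I_L -> R)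
    (x : R -> R) : Prop :=
  forall t,
    (fun N : nat => \sum_(i < (2 * N).+1) \sum_(l < L)
        a l * h (t - tau l - ((i%:R - N%:R) * T)))
      @ \oo --> x t.

Definition sup_abs (y : R -> R) (c : R) : Prop :=
  (forall t, `|y t| <= c) /\ (forall e, 0 < e -> exists t, c - e < `|y t|).

(* firing instants of the IF-TEM with parameters b, kappa, delta, started
   (integrator reset) at time t0:  t_0 = t0 and t_{n+1} is the first time
   after t_n with (1/kappa) \int_{t_n}^{t_{n+1}} (y(s) + b) ds = delta *)
Definition iftem_instants (y : R -> R) (b kappa delta t0 : R)
    (tn : nat -> R) : Prop :=
  tn 0%N = t0 /\
  forall n : nat,
    tn n < tn n.+1 /\
    Rintegral lebm `[tn n, tn n.+1] (fun s => y s + b) / kappa = delta /\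
    (forall s, tn n < s < tn n.+1 ->
       Rintegral lebm `[tn n, s] (fun s => y s + b) / kappa < delta).

Definition same_instants_in (t0 T : R) (tn tn' : nat -> R) : Prop :=
  forall s, t0 <= s <= t0 + T ->
    ((exists n, tn n = s) <-> (exists n, tn' n = s)).

End IFTEM_defs.

(* Main.v *)
(* The periodization of a kernel [g] whose Fourier transform is the indicator of
   [-K, K] on the frequencies [k w0] is the Dirichlet kernel, so [y = x * g] is
   a trigonometric polynomial of degree at most [K] whose coefficients are
   [FT h (k w0) * \sum_l a_l e^(-j k w0 tau_l)]. The rate condition
   puts at least [2K + 2] firing instants after [t0] in [[t0, t0 + T]]; equal
   instants make the integral of [y - y'] vanish between consecutive ones, so
   [y - y'] has more zeros in one period than its degree allows and is zero.
   Equality of the [2K + 1 > 2L] coefficients is then a Prony system, which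
   determines amplitudes and nodes. *)
Require Import Defs.
From HB Require Import structures.
From mathcomp Require Import all_boot all_order all_algebra.
From mathcomp Require Import all_classical all_reals all_analysis.
From mathcomp Require Import measurable_realfun.
From mathcomp Require Import ring lra zify.
From mathcomp Require Import complex.
Set Implicit Arguments.
Unset Strict Implicit.
Unset Printing Implicit Defensive.
Import Order.TTheory GRing.Theory Num.Theory.
Import numFieldNormedType.Exports.
Local Open Scope classical_set_scope.
Local Open Scope ring_scope.

(** Since [g] is only integrable, its periodization converges almost everywhere and is known only
    through its Fourier coefficients; identifying it with the Dirichlet kernel takes uniqueness of
    Fourier coefficients in L^1 of a period. A function orthogonal to all cosines of all phases is
    orthogonal to polynomials in one shifted cosine; these approximate indicators of arcs boundedly,
    so its primitive vanishes, and so does the function almost everywhere. A second obstacle is that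
    convergence of symmetric sums alone does not make [x] periodic: a shift by [T] changes the
    partial sums by two end terms. These vanish in the limit wherever the sums of absolute values
    are bounded, that is almost everywhere, which is enough to unfold the convolution. In the zero
    count, multiplying by [e^(jKwt)] gives a polynomial of degree at most 2K in [e^(jwt)], and the
    2K+1 gaps between [t_0, ..., t_(2K+1)] supply one root more than that. *)

(** * Translations and reflections of Lebesgue measure *)

Section isometries.
Context {R : realType}.
Local Notation mu := (@lebesgue_measure R).

(** Half-open intervals suffice: Lebesgue measure is characterized by its values on them, which is
    how [measure_preserving] reaches all measurable sets. *)
Lemma lebesgue_measure_ocitv_shift (a : R) (X : set (measurableTypeR R)) :
  ocitv X -> mu X = pushforward mu (fun x : R => x + a : measurableTypeR R) X.
Proof.
case=> [[u v] /= _ <-]; rewrite /pushforward.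
have -> : (fun x : R => x + a) @^-1` `]u, v] = `](u - a), (v - a)]%classic.
  by apply/seteqP; split => x /=; rewrite !in_itv /= ltrBlDr lerBrDr.
rewrite !lebesgue_measure_itv /= !lte_fin ltrD2r.
by case: ifPn => // _; rewrite -!EFinB; congr EFin; ring.
Qed.

Lemma lebesgue_measure_ocitv_flip (a : R) (X : set (measurableTypeR R)) :
  ocitv X -> mu X = pushforward mu (fun x : R => a - x : measurableTypeR R) X.
Proof.
case=> [[u v] /= _ <-]; rewrite /pushforward.
have -> : (fun x : R => a - x) @^-1` `]u, v] = `[(a - v), (a - u)[%classic.
  apply/seteqP; split => x /=; rewrite !in_itv /= ltrBrDr lerBlDr.
    by rewrite ltrBrDr lerBlDr (addrC x u) (addrC x v) => /andP[-> ->].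
  by rewrite ltrBrDr lerBlDr (addrC x u) (addrC x v) => /andP[-> ->].
rewrite !lebesgue_measure_itv /= !lte_fin ltrD2l ltrN2.
by case: ifPn => // _; rewrite -!EFinB; congr EFin; ring.
Qed.

Lemma measurable_shift (a : R) :
  measurable_fun setT (fun x : measurableTypeR R => x + a : measurableTypeR R).
Proof. exact: measurable_funD. Qed.

Lemma measurable_flip (a : R) :
  measurable_fun setT (fun x : measurableTypeR R => a - x : measurableTypeR R).
Proof. exact: measurable_funB. Qed.

End isometries.

(** * Change of variables along a measure-preserving map *)

Section measure_preserving.
Context {R : realType}.
Local Notation mu := (@lebesgue_measure R).
Variable phi : measurableTypeR R -> measurableTypeR R.
Hypothesis mphi : measurable_fun setT phi.
Hypothesis muphi : forall X, ocitv X -> mu X = pushforward mu phi X.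

Let phi_ : {mfun measurableTypeR R >-> measurableTypeR R} :=
  HB.pack phi (isMeasurableFun.Build _ _ _ _ phi mphi).

Lemma measure_preserving (A : set (measurableTypeR R)) :
  measurable A -> mu A = pushforward mu phi A.
Proof. exact: (@lebesgue_measure_unique R (pushforward mu phi_)). Qed.

Lemma integrable_measure_preserving (f : R -> R) :
  mu.-integrable setT (EFin \o f) -> mu.-integrable setT (EFin \o (f \o phi)).
Proof.
move=> /integrableP[mf fi]; apply/integrableP; split.
  apply/measurable_EFinP; apply: measurableT_comp => //.
  exact/measurable_EFinP.
rewrite [ltLHS](_ : _ = \int[mu]_x `|(EFin \o f) x|)%E//.
rewrite -[LHS](@ge0_integral_pushforward _ _ _ _ _ phi mphi mu setT (fun x => `|(EFin \o f) x|)%E) //; last exact: measurableT_comp.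
by apply: eq_measure_integral => A mA _; exact/esym/measure_preserving.
Qed.

Lemma Rintegral_measure_preserving (f : R -> R) :
  mu.-integrable setT (EFin \o f) ->
  Rintegral mu setT (f \o phi) = Rintegral mu setT f.
Proof.
move=> fi; rewrite /Rintegral; congr fine.
have fpi := integrable_measure_preserving fi.
move: fi => /integrableP[mf fi].
rewrite -[LHS](@integral_pushforward _ _ _ _ _ phi mphi mu setT (EFin \o f)) //.
by apply: eq_measure_integral => A mA _; exact/esym/measure_preserving.
Qed.

End measure_preserving.

(** * Symmetric sums over the periods *)

Section periodization.
Context {R : realType}.
Local Notation mu := (@lebesgue_measure R).
Variable T : R.

(** The truncation [|p| <= N] with the indexing of [FRI_signal], so that the two sums match term by
    term. *)
Definition psum (f : R -> R) (N : nat) (t : R) : R :=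
  \sum_(i < (2 * N).+1) f (t - (i%:R - N%:R) * T).

Lemma psum0 f t : psum f 0 t = f t.
Proof. by rewrite /psum big_ord1 subrr mul0r subr0. Qed.

Lemma psumS f N t :
  psum f N.+1 t = psum f N t + (f (t + N.+1%:R * T) + f (t - N.+1%:R * T)).
Proof.
rewrite /psum.
have -> : (2 * N.+1).+1 = (2 * N).+1.+2 by lia.
rewrite big_ord_recl big_ord_recr /= addrCA; congr (_ + (_ + _)).
- by apply: eq_bigr => i _; congr (f _); rewrite /bump /= add1n; ring.
- by congr (f _); ring.
- by congr (f _); rewrite /bump /= add1n; ring.
Qed.

Lemma psumB f g N t : psum (f \- g) N t = psum f N t - psum g N t.
Proof. by rewrite /psum -sumrB. Qed.

Lemma normr_psum_le f N t : `|psum f N t| <= psum (Num.norm \o f) N t.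
Proof. exact: ler_norm_sum. Qed.

Lemma psum_ge0 f N t : (forall x, 0 <= f x) -> 0 <= psum f N t.
Proof. by move=> f0; apply: sumr_ge0. Qed.

Lemma nondecreasing_psum f t :
  (forall x, 0 <= f x) -> nondecreasing_seq (fun N => psum f N t).
Proof.
by move=> f0; apply/nondecreasing_seqP => N; rewrite psumS lerDl addr_ge0.
Qed.

(** A shift by one period slides the window of summation: one term enters at one end, one leaves at
    the other. *)
Lemma psum_addT f N t :
  psum f N (t + T) = psum f N t + f (t + N.+1%:R * T) - f (t - N%:R * T).
Proof.
elim: N => [|N IH]; first by rewrite !psum0 mul1r mul0r subr0; ring.
rewrite !psumS IH.
have -> : t + T + N.+1%:R * T = t + N.+2%:R * T by ring.
have -> : t + T - N.+1%:R * T = t - N%:R * T by ring.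
ring.
Qed.

(** Write [f] as [|f| - (|f| - f)]: both sums have nonnegative terms, hence are monotone, with
    bounds [M] and [2M]. *)
Lemma is_cvg_psum f t M :
  (forall N, psum (Num.norm \o f) N t <= M) -> cvgn (fun N => psum f N t).
Proof.
move=> fM.
have -> : (fun N => psum f N t) = (fun N => psum (Num.norm \o f) N t) \-
   (fun N => psum ((Num.norm \o f) \- f) N t).
  by apply/funext => N /=; rewrite psumB opprB addrC subrK.
apply: is_cvgB; apply: nondecreasing_is_cvgn.
- by apply: nondecreasing_psum => x /=.
- by exists M => _ [N _ <-].
- by apply: nondecreasing_psum => x /=; rewrite subr_ge0 ler_norm.
- exists (M + M) => _ [N _ <-]; rewrite psumB lerD//.
  apply: (le_trans _ (fM N)); apply: (le_trans _ (normr_psum_le _ _ _)).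
  by rewrite -normrN ler_norm.
Qed.

(** Each new term is at most one increment of the convergent sums of [|f|]. *)
Lemma psum_terms_cvg0 f t M :
  (forall N, psum (Num.norm \o f) N t <= M) ->
  ((fun n : nat => f (t + n%:R * T)) @ \oo --> (0 : R)) /\
  ((fun n : nat => f (t - n%:R * T)) @ \oo --> (0 : R)).
Proof.
move=> fM.
have c : cvgn (fun N => psum (Num.norm \o f) N t).
  by apply: (@is_cvg_psum _ _ M) => N; rewrite (le_trans _ (fM N))// ler_sum// => i _ /=; rewrite normr_id.
have d0 : (fun N => psum (Num.norm \o f) N.+1 t - psum (Num.norm \o f) N t) @ \oo --> (0 : R).
  rewrite -(subrr (limn (fun N => psum (Num.norm \o f) N t))); apply: cvgB => //.
  by rewrite (cvg_shiftS (fun N => psum (Num.norm \o f) N t)).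
have dle N : `|f (t + N.+1%:R * T)| <= psum (Num.norm \o f) N.+1 t - psum (Num.norm \o f) N t /\
   `|f (t - N.+1%:R * T)| <= psum (Num.norm \o f) N.+1 t - psum (Num.norm \o f) N t.
  by rewrite psumS addrAC subrr add0r /= lerDl lerDr !normr_ge0.
have sq (u : nat -> R) : (forall N, `|u N.+1| <=
    psum (Num.norm \o f) N.+1 t - psum (Num.norm \o f) N t) -> u @ \oo --> (0 : R).
  move=> ud; rewrite -(cvg_shiftS u); apply: norm_cvg0.
  apply: (squeeze_cvgr _ (cvg_cst (0 : R)) d0); apply: nearW => N /=.
  by rewrite normr_ge0 ud.
by split; apply: sq => N; case: (dle N).
Qed.

Lemma Rintegral_shift (f : R -> R) (a : R) (u v : R) :
  mu.-integrable setT (EFin \o f) ->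
  Rintegral mu `[u, v[ (fun t => f (t + a)) = Rintegral mu `[u + a, v + a[ f.
Proof.
move=> fi; rewrite Rintegral_mkcond [RHS]Rintegral_mkcond.
rewrite -[RHS](Rintegral_measure_preserving (measurable_shift a) (@lebesgue_measure_ocitv_shift _ a)).
  congr Rintegral; apply/funext => t /=; rewrite !patchE.
  rewrite !mem_setE /= !in_itv /=. by rewrite lerD2r ltrD2r.
rewrite -restrict_EFin.
have mI : measurable (`[u + a, v + a[%classic : set (measurableTypeR R)) by [].
apply: (proj1 (integrable_mkcond _ mI)).
exact: (integrableS measurableT _ _ fi).
Qed.

Lemma integrable_shift (f : R -> R) (a : R) :
  mu.-integrable setT (EFin \o f) ->
  mu.-integrable setT (EFin \o (fun t => f (t + a))).
Proof.
exact: (integrable_measure_preserving (measurable_shift a) (@lebesgue_measure_ocitv_shift _ a)).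
Qed.

Lemma integrable_psum (f : R -> R) N :
  mu.-integrable setT (EFin \o f) -> mu.-integrable setT (EFin \o psum f N).
Proof.
move=> fi; elim: N => [|N IH].
  by apply: eq_integrable fi => // x _ /=; rewrite psum0.
have := integrableD measurableT IH (integrableD measurableT
   (integrable_shift (N.+1%:R * T) fi) (integrable_shift (- (N.+1%:R * T)) fi)).
by apply: eq_integrable => // x _ /=; rewrite psumS -!EFinD.
Qed.

Lemma integrableST (A : set R) (f : R -> R) : measurable A ->
  mu.-integrable setT (EFin \o f) -> mu.-integrable A (EFin \o f).
Proof. by move=> mA; apply: (integrableS measurableT). Qed.

Lemma Rintegral_itv_cat (f : R -> R) (u v w : R) :
  mu.-integrable setT (EFin \o f) -> u <= v -> v <= w ->
  Rintegral mu `[u, w[ f = Rintegral mu `[u, v[ f + Rintegral mu `[v, w[ f.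
Proof.
move=> fi uv vw; rewrite -Rintegral_setU//.
- congr Rintegral; apply/seteqP; split => x /=; rewrite !in_itv /=.
    by move=> /andP[ux xw]; case: (ltP x v) => h; [left; rewrite ux|right].
  by case=> /andP[ux xw]; apply/andP; split => //; lra.
- by apply: integrableST => //; exact: measurableU.
- apply/disj_setPS => x [] /=; rewrite !in_itv /= => /andP[_ ?] /andP[? _]; lra.
Qed.

Hypothesis T0 : 0 < T.

(** The translates of the half-open period tile the window exactly; passing from [N] to [N + 1] adds
    one tile at each end. *)
Lemma Rintegral_psum (f : R -> R) N : mu.-integrable setT (EFin \o f) ->
  Rintegral mu `[0, T[ (psum f N) = Rintegral mu `[- (N%:R * T), N.+1%:R * T[ f.
Proof.
move=> fi; elim: N => [|N IH].
  rewrite mul0r oppr0 mul1r; apply: eq_Rintegral => x _.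
  exact: psum0.
have -> : psum f N.+1 = fun t =>
    psum f N t + (f (t + N.+1%:R * T) + f (t - N.+1%:R * T)).
  by apply/funext => t; exact: psumS.
rewrite RintegralD//; [|by apply/integrableST => //; exact: integrable_psum|]; last first.
  have mD : measurable (`[0, T[%classic : set (measurableTypeR R)) by [].
  have := integrableD mD (integrableST mD (integrable_shift (N.+1%:R * T) fi))
    (integrableST mD (integrable_shift (- (N.+1%:R * T)) fi)).
  by apply: eq_integrable => // x _ /=; rewrite -EFinD.
rewrite RintegralD//; [|by apply/integrableST => //; exact: integrable_shift..].
rewrite IH !Rintegral_shift// !add0r.
have NT : 0 <= N%:R * T by rewrite mulr_ge0// ltW.
have -> : N.+2%:R * T = N%:R * T + T + T by ring.
have -> : N.+1%:R * T = N%:R * T + T by ring.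
move: NT {IH}; move: (N%:R * T) => p p0.
have T1 := T0.
rewrite (@Rintegral_itv_cat f (- (p + T)) (- p) (p + T + T))//; [|lra..].
rewrite (@Rintegral_itv_cat f (- p) (p + T) (p + T + T))//; [|lra..].
have -> : T + (p + T) = p + T + T by ring.
have -> : T - (p + T) = - p by ring.
ring.
Qed.

End periodization.

(** * Integrals of periodizations *)

Section periodization_integral.
Context {R : realType}.
Local Notation mu := (@lebesgue_measure R).
Variable T : R.
Hypothesis T0 : 0 < T.
Local Notation D := (`[0, T[%classic : set (measurableTypeR R)).

Let mD : measurable D. Proof. by []. Qed.

Lemma EFin_Rintegral (A : set (measurableTypeR R)) (f : R -> R) :
  measurable A -> mu.-integrable A (EFin \o f) ->
  (Rintegral mu A f)%:E = (\int[mu]_(x in A) (f x)%:E)%E.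
Proof. by move=> mA fi; rewrite /Rintegral fineK//; exact: integrable_fin_num. Qed.

Lemma cvg_Rintegral_itv (f : R -> R) : mu.-integrable setT (EFin \o f) ->
  (fun N : nat => Rintegral mu `[- (N%:R * T), N.+1%:R * T[ f) @ \oo -->
    Rintegral mu setT f.
Proof.
move=> fi.
pose I N : set (measurableTypeR R) := `[- (N%:R * T), N.+1%:R * T[%classic.
have mI N : measurable (I N) by exact: measurable_itv.
have mf : measurable_fun setT (EFin \o f) by move/integrableP: fi => [].
have h := @dominated_convergence _ _ R mu setT measurableT
  (fun N => EFin \o (f \_ (I N))) (EFin \o f) (abse \o (EFin \o f)).
have [|//|||//|_ _] := h.
- move=> N; rewrite -restrict_EFin.
  apply: (proj1 (measurable_restrictT _ (mI N))).
  exact: measurable_funS mf.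
- apply: aeW => x _; apply: cvg_EFin => /=; first exact: nearW.
  apply: cvg_near_cst.
  near=> N; rewrite /= patchE ifT// mem_setE in_itv /=.
  have xN : `|x| < N%:R * T.
    by rewrite -ltr_pdivrMr//; near: N; exact: nbhs_infty_gtr.
  have := ler_norm x; have := ler_norm (- x); rewrite normrN => h1 h2.
  rewrite lerNl (le_trans h1 (ltW xN))/= (le_lt_trans h2)// (lt_trans xN)//.
  by rewrite ltr_pM2r// ltr_nat.
- exact: integrable_abse.
- apply: aeW => x N _ /=; rewrite patchE; case: ifP => // _ /=.
  by rewrite normr0 lee_fin.
rewrite -[X in _ --> X -> _]EFin_Rintegral// => /fine_cvg; apply: cvg_trans.
apply: near_eq_cvg; apply: nearW => N /=; congr fine.
by rewrite integral_mkcond restrict_EFin.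
Unshelve. all: by end_near. Qed.

(** The dominating function is the whole periodization of [|f|], extended-valued since it may be
    infinite on a null set. By monotone convergence its integral over a period is at most that of
    [|f|] over the line. *)
Lemma psum_normr_dominated (f : R -> R) : mu.-integrable setT (EFin \o f) ->
  exists2 M : R -> \bar R, mu.-integrable D M &
    forall N t, ((psum T (Num.norm \o f) N t)%:E <= M t)%E.
Proof.
move=> fi.
have ai : mu.-integrable setT (EFin \o (Num.norm \o f)).
  exact: integrable_norm.
pose u N t := (psum T (Num.norm \o f) N t)%:E.
have u0 N t : D t -> (0 <= u N t)%E.
  by move=> _; rewrite lee_fin psum_ge0// => x /=.
have und t : D t -> nondecreasing_seq (u ^~ t).
  by move=> _ m n mn; rewrite lee_fin nondecreasing_psum// => x /=.
have ui N : mu.-integrable D (u N) by apply: integrableST => //; exact: integrable_psum.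
have mu_ N : measurable_fun D (u N) by move/integrableP: (ui N) => [].
exists (fun t => limn (u ^~ t)).
  have mlim : measurable_fun D (fun t => limn (u ^~ t)).
    apply: emeasurable_fun_cvg mu_ _ => t Dt.
    exact: ereal_nondecreasing_is_cvgn (und t Dt).
  apply/integrableP; split => //.
  under eq_integral => t /[!inE] Dt.
    rewrite gee0_abs; last first.
      apply: lime_ge; first exact: ereal_nondecreasing_is_cvgn (und t Dt).
      by apply: nearW => N; exact: u0.
    over.
  rewrite /= monotone_convergence//.
  apply: (@le_lt_trans _ _ (Rintegral mu setT (Num.norm \o f))%:E); last exact: ltry.
  apply: lime_le.
    apply: ereal_nondecreasing_is_cvgn => m n mn.
    by apply: ge0_le_integral => //; move=> t Dt; [exact: u0|exact: und].
  apply: nearW => N.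
  rewrite -(EFin_Rintegral mD (ui N)) lee_fin Rintegral_psum//.
  have mI : measurable (`[(- (N%:R * T)), (N.+1%:R * T)[%classic : set (measurableTypeR R)) by [].
  rewrite -lee_fin !EFin_Rintegral//; last exact: integrableST.
  apply: ge0_subset_integral => //; first exact: measurable_int ai.
  by move=> x _; rewrite lee_fin /=.
move=> N t.
have nd : nondecreasing_seq (u ^~ t).
  by move=> m n mn; rewrite lee_fin nondecreasing_psum// => x /=.
apply: lime_ge; first exact: ereal_nondecreasing_is_cvgn.
by exists N => // n /= Nn; exact: nd.
Qed.


Lemma psum_normr_bounded_ae (f : R -> R) : mu.-integrable setT (EFin \o f) ->
  {ae mu, forall t, D t -> exists M, forall N, psum T (Num.norm \o f) N t <= M}.
Proof.
move=> /psum_normr_dominated[M Mi fM].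
have := integrable_ae mD Mi; apply: filterS => t /[apply] Mt.
by exists (fine (M t)) => N; rewrite -lee_fin fineK.
Qed.

(** The integrals of [psum] over a period tend to that of [F] by dominated convergence; by tiling
    they are also integrals of [f] over windows growing to the line. *)
Theorem periodization (f F : R -> R) : mu.-integrable setT (EFin \o f) ->
  measurable_fun D F ->
  {ae mu, forall t, D t -> psum T f ^~ t @ \oo --> F t} ->
  mu.-integrable D (EFin \o F) /\ Rintegral mu D F = Rintegral mu setT f.
Proof.
move=> fi mF fF; have [M Mi fM] := psum_normr_dominated fi.
have pi_ N : mu.-integrable D (EFin \o psum T f N).
  by apply: integrableST => //; exact: integrable_psum.
have h := @dominated_convergence _ _ R mu D mD
  (fun N => EFin \o psum T f N) (EFin \o F) M.
have [||||Fi _ hlim] := h _ _ _ Mi.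
- by move=> N; exact: measurable_int (pi_ N).
- exact/measurable_EFinP.
- apply: filterS fF => t /[apply] ft.
  by apply: cvg_EFin; [exact: nearW|exact: ft].
- apply: aeW => t N _ /=; apply: le_trans (fM N t).
  by rewrite lee_fin normr_psum_le.
split=> //.
have h1 : (fun N => Rintegral mu D (psum T f N)) @ \oo --> Rintegral mu D F.
  move: hlim; rewrite -[X in _ --> X -> _]EFin_Rintegral// => /fine_cvg.
  by apply: cvg_trans.
have h2 := cvg_Rintegral_itv fi.
rewrite -(cvg_lim _ h1)// -(cvg_lim _ h2)//.
by congr (limn _); apply/funext => N; rewrite Rintegral_psum.
Qed.

(** The upper limit is measurable without any convergence and agrees with the limit wherever the
    sums of [|f|] are bounded; its infinite values, sent to 0 by [fine], fall in the exceptional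
    null set. *)
Lemma periodization_exists (f : R -> R) : mu.-integrable setT (EFin \o f) ->
  exists2 F : R -> R, measurable_fun D F &
  {ae mu, forall t, D t -> psum T f ^~ t @ \oo --> F t}.
Proof.
move=> fi; exists (fun t => fine (limn_esup (fun N => (psum T f N t)%:E))).
  apply: measurableT_comp => //; apply: measurable_fun_limn_esup => N.
  apply: (measurable_int mu); apply: integrableST => //.
  exact: integrable_psum.
apply: filterS (psum_normr_bounded_ae fi) => t /[apply] -[M fM].
have c := is_cvg_psum fM.
have c' : (fun N => (psum T f N t)%:E) @ \oo --> (limn (psum T f ^~ t))%:E.
  by apply: cvg_EFin => //; exact: nearW.
rewrite is_cvg_limn_esupE; last by apply/cvg_ex; eexists; exact: c'.
by rewrite (cvg_lim _ c').
Qed.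

End periodization_integral.

(** * Polynomials converging to a step function *)

Section step_polynomials.
Context {R : realType}.

Lemma bernoulli_le (x : R) n : 0 <= x -> 1 + n%:R * x <= (1 + x) ^+ n.
Proof.
move=> x0; elim: n => [|n IH]; first by rewrite mul0r addr0 expr0.
rewrite exprS; apply: (@le_trans _ _ ((1 + x) * (1 + n%:R * x))).
  have : 0 <= n%:R * x ^+ 2 by rewrite mulr_ge0// sqr_ge0.
  rewrite -natr1; nra.
by rewrite ler_wpM2l// addr_ge0.
Qed.

Lemma bernoulli_ge (x : R) n : 0 <= x <= 1 -> 1 - n%:R * x <= (1 - x) ^+ n.
Proof.
move=> /andP[x0 x1]; elim: n => [|n IH]; first by rewrite mul0r subr0 expr0.
rewrite exprS; apply: (@le_trans _ _ ((1 - x) * (1 - n%:R * x))).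
  have : 0 <= n%:R * x ^+ 2 by rewrite mulr_ge0// sqr_ge0.
  rewrite -natr1; nra.
by rewrite ler_wpM2l// subr_ge0.
Qed.

(* The sequence of the classical proof of the Stone-Weierstrass theorem: on
   [0, 1] it tends to 0 below 1/2 and to 1 above. *)
Definition step_seq (w : R) (n : nat) : R := 1 - (1 - w ^+ n) ^+ (2 ^ n).

Lemma step_seq_itv (w : R) n : 0 <= w <= 1 -> 0 <= step_seq w n <= 1.
Proof.
move=> /andP[w0 w1].
have wn : 0 <= w ^+ n <= 1 by rewrite exprn_ge0//= exprn_ile1.
have : 0 <= (1 - w ^+ n) ^+ (2 ^ n) <= 1.
  rewrite exprn_ge0 ?exprn_ile1 //=; lra.
rewrite /step_seq; lra.
Qed.

(** Bernoulli bounds [step_seq w n] by [(2w)^n]. *)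
Lemma step_seq_cvg0 (w : R) : 0 <= w < 2^-1 -> step_seq w @ \oo --> (0 : R).
Proof.
move=> /andP[w0 w1].
have c : (fun n => (2 * w) ^+ n) @ \oo --> (0 : R).
  by apply: cvg_expr; rewrite ger0_norm; lra.
apply: (squeeze_cvgr _ (cvg_cst (0 : R)) c); apply: nearW => n.
have /andP[-> _] /= := @step_seq_itv w n ltac:(lra).
have wn : 0 <= w ^+ n <= 1 by rewrite exprn_ge0//= exprn_ile1//; lra.
have := bernoulli_ge (2 ^ n) wn.
rewrite /step_seq exprMn natrX; lra.
Qed.

(** Since [(1 - w^n)(1 + w^n) <= 1], Bernoulli for [1 + w^n] bounds the subtracted power by
    [(2w)^-n]. *)
Lemma step_seq_cvg1 (w : R) : 2^-1 < w <= 1 -> step_seq w @ \oo --> (1 : R).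
Proof.
move=> /andP[w0 w1].
have c : (fun n => 1 - ((2 * w)^-1) ^+ n) @ \oo --> (1 : R).
  rewrite -[X in _ --> X]subr0; apply: cvgB; first exact: cvg_cst.
  apply: cvg_expr; rewrite ger0_norm ?invr_ge0; last lra.
  by rewrite invf_lt1; lra.
apply: (squeeze_cvgr _ c (cvg_cst (1 : R))); apply: nearW => n.
have /andP[_ ->] /= := @step_seq_itv w n ltac:(lra).
rewrite andbT /step_seq lerD2l lerN2 exprVn.
have wn : 0 <= w ^+ n <= 1 by rewrite exprn_ge0 ?exprn_ile1//; lra.
have wp : 0 < w ^+ n by rewrite exprn_gt0//; lra.
have /andP[wn0 _] := wn.
have h1 : (1 - w ^+ n) ^+ (2 ^ n) * (1 + w ^+ n) ^+ (2 ^ n) <= 1.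
  rewrite -exprMn exprn_ile1//; nra.
have h2 := bernoulli_le (2 ^ n) wn0.
have p2 : 0 < (2 * w) ^+ n by rewrite exprn_gt0//; lra.
have p0 : 0 <= (1 - w ^+ n) ^+ (2 ^ n) by rewrite exprn_ge0//; lra.
rewrite -[leRHS]mul1r ler_pdivlMr//.
apply: le_trans h1; apply: ler_wpM2l => //; apply: le_trans h2.
by rewrite natrX exprMn; lra.
Qed.

Lemma cos_lt_cos (t x : R) : 0 <= t <= pi -> t < x < 2 * pi - t -> cos x < cos t.
Proof.
move=> /andP[t0 tp] /andP[tx xt].
have [xp|px] := leP x pi.
  by rewrite ltr_cos ?in_itv /=; lra.
rewrite -[cos x](_ : cos (2 * pi - x) = _).
  by rewrite ltr_cos ?in_itv /=; lra.
by rewrite cosB mulr_natl cos2pi sin2pi mul1r mul0r addr0.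
Qed.

Lemma cos_norm (x : R) : cos `|x| = cos x.
Proof. by have [_|_] := ger0P x; rewrite ?cosN. Qed.

End step_polynomials.

(** * Orthogonality to cosines and to polynomials in a cosine *)

Section fourier_uniqueness.
Context {R : realType}.
Local Notation mu := (@lebesgue_measure R).

Lemma integrableM_bounded (A : set (measurableTypeR R)) (f q : R -> R) (C : R) :
  measurable A -> mu.-integrable A (EFin \o f) -> measurable_fun A q ->
  (forall x, A x -> `|q x| <= C) ->
  mu.-integrable A (EFin \o (fun x => f x * q x)).
Proof.
move=> mA fi mq qC.
have := @integrableMr _ _ R mu A mA q (EFin \o f) mq _ fi.
have bq : [bounded q x | x in A].
  exists C; split; first exact: num_real.
  by move=> M CM x /= Ax; rewrite (le_trans (qC _ Ax))// ltW.
move=> /(_ bq); apply: eq_integrable => // x _ /=.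
by rewrite -EFinM mulrC.
Qed.

Lemma measurable_cos_affine (A : set (measurableTypeR R)) (k s : R) : measurable A ->
  measurable_fun A (fun r : R => cos (k * r + s)).
Proof.
move=> mA; apply: measurable_funTS; apply: continuous_measurable_fun => x.
apply: continuous_comp; last exact: continuous_cos.
by apply: continuousD; [apply: continuousM; [exact: cvg_cst|]|exact: cvg_cst].
Qed.

Lemma integrableM_cos (A : set (measurableTypeR R)) (f : R -> R) (k s : R) :
  measurable A -> mu.-integrable A (EFin \o f) ->
  mu.-integrable A (EFin \o (fun r => f r * cos (k * r + s))).
Proof.
move=> mA fi; apply: (@integrableM_bounded _ _ _ 1) => //.
  exact: measurable_cos_affine.
by move=> x _; rewrite ler_norml cos_geN1 cos_le1.
Qed.

Variable T : R.
Hypothesis T0 : 0 < T.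
Local Notation D := (`[0, T[%classic : set (measurableTypeR R)).
Local Notation w := (omega0 T).

Let mD : measurable D. Proof. by []. Qed.

(** The free phase [s] covers cosines and sines at once and makes the property stable under
    multiplication by a shifted cosine. *)
Definition trig_orthogonal (f : R -> R) : Prop :=
  forall (k : int) (s : R),
    Rintegral mu D (fun r => f r * cos (k%:~R * w * r + s)) = 0.

(** The product-to-sum formula only moves the frequency [k] to [k + 1] and [k - 1]. *)
Lemma trig_orthogonalM_cos (f : R -> R) (c : R) :
  mu.-integrable D (EFin \o f) -> trig_orthogonal f ->
  trig_orthogonal (fun r => f r * cos (w * r + c)).
Proof.
move=> fi fo k s.
have -> : (fun r => f r * cos (w * r + c) * cos (k%:~R * w * r + s)) =
  (fun r => 2^-1 * (f r * cos ((k + 1)%:~R * w * r + (s + c)) +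
    f r * cos ((k - 1)%:~R * w * r + (s - c)))).
  apply/funext => r.
  have -> : (k + 1)%:~R * w * r + (s + c) = (k%:~R * w * r + s) + (w * r + c) by ring.
  have -> : (k - 1)%:~R * w * r + (s - c) = (k%:~R * w * r + s) - (w * r + c) by ring.
  by rewrite [in RHS]cosD cosB; field.
have i1 := integrableM_cos ((k + 1)%:~R * w) (s + c) mD fi.
have i2 := integrableM_cos ((k - 1)%:~R * w) (s - c) mD fi.
rewrite RintegralZl//; last first.
  by apply: eq_integrable (integrableD mD i1 i2) => // x _ /=; rewrite -EFinD.
by rewrite RintegralD// !fo addr0 mulr0.
Qed.

Lemma trig_orthogonal_horner (f : R -> R) (c : R) (p : {poly R}) :
  mu.-integrable D (EFin \o f) -> trig_orthogonal f ->
  mu.-integrable D (EFin \o (fun r => f r * p.[cos (w * r + c)])) /\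
  trig_orthogonal (fun r => f r * p.[cos (w * r + c)]).
Proof.
move=> fi fo; elim/poly_ind: p => [|p a [IHi IHo]].
  have -> : (fun r => f r * (0 : {poly R}).[cos (w * r + c)]) = cst 0.
    by apply/funext => r; rewrite horner0 mulr0.
  split; first exact: integrable0.
  move=> k s; rewrite (_ : (fun _ => _) = cst 0) ?Rintegral_cst ?mul0r//.
  by apply/funext => r; rewrite mul0r.
have -> : (fun r => f r * (p * 'X + a%:P).[cos (w * r + c)]) =
  (fun r => (f r * p.[cos (w * r + c)]) * cos (w * r + c) + a * f r).
  by apply/funext => r; rewrite hornerMXaddC; ring.
have i1 := integrableM_cos w c mD IHi.
have o1 := trig_orthogonalM_cos c IHi IHo.
have i2 : mu.-integrable D (EFin \o (fun r => a * f r)).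
  by apply: eq_integrable (integrableZl mD a fi) => // x _ /=; rewrite -EFinM.
split.
  by apply: eq_integrable (integrableD mD i1 i2) => // x _ /=; rewrite -EFinD.
move=> k s; under eq_Rintegral do rewrite mulrDl -(mulrA a).
rewrite RintegralD//; [|exact: integrableM_cos..|].
  have i3 := integrableM_cos (k%:~R * w) s mD fi.
  by rewrite RintegralZl// o1 fo mulr0 addr0.
by apply: eq_integrable (integrableZl mD a (integrableM_cos (k%:~R * w) s mD fi)).
Qed.

End fourier_uniqueness.

(** * Uniqueness of Fourier coefficients of integrable functions *)

Section fourier_uniqueness_ae.
Context {R : realType}.
Local Notation mu := (@lebesgue_measure R).
Variable T : R.
Hypothesis T0 : 0 < T.
Local Notation D := (`[0, T[%classic : set (measurableTypeR R)).
Local Notation w := (omega0 T).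

Let mD : measurable D. Proof. by []. Qed.

Lemma omega0_gt0 : 0 < w.
Proof. by rewrite divr_gt0// mulr_gt0// pi_gt0. Qed.

Lemma omega0M : w * T = 2 * pi.
Proof. by rewrite /omega0 mulfVK// gt_eqF. Qed.

(** For [b >= 1] the substitution [(1 + z) / (2b)] maps [[-1, 1]] into [[0, 1]], and it moves the
    threshold 1/2 to [z = b - 1]. *)
Let step_poly (b : R) (n : nat) : {poly R} :=
  1 - (1 - ((2 * b)^-1 *: ('X + 1)) ^+ n) ^+ (2 ^ n).

Let step_polyE b n z : (step_poly b n).[z] = step_seq ((1 + z) / (2 * b)) n.
Proof. by rewrite /step_poly /step_seq !hornerE /= (addrC z) (mulrC _^-1). Qed.

(* The arc around the midpoint of ]u, v[ is a superlevel set of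
   [cos (w * (r - (u + v) / 2))], so its indicator is a bounded limit of
   polynomials in this cosine. *)
Lemma trig_orthogonal_itv (f : R -> R) (u v : R) :
  mu.-integrable D (EFin \o f) -> trig_orthogonal T f ->
  0 <= u -> u < v -> v <= T -> v - u <= T / 2 ->
  Rintegral mu `]u, v[ f = 0.
Proof.
move=> fi fo u0 uv vT vu.
have w0 := omega0_gt0; have wT := omega0M.
(* [th] is the half-width of the arc as an angle, and [b = 1 + cos th] puts the threshold at its
   endpoints. The bound [v - u <= T / 2] gives [th <= pi / 2], hence [b >= 1]. *)
pose m := (u + v) / 2; pose th := w * ((v - u) / 2); pose b := 1 + cos th.
pose I : set (measurableTypeR R) := `]u, v[%classic.
have mI : measurable I by exact: measurable_itv.
have th0 : 0 < th by rewrite mulr_gt0//; lra.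
have thp : th <= pi / 2.
  rewrite (_ : pi / 2 = w * (T / 4)); last by rewrite mulrA wT; field.
  by rewrite ler_pM2l//; lra.
have cth0 : 0 <= cos th by apply: cos_ge0_pihalf; have := @pi_gt0 R; lra.
have cth1 : cos th < 1.
  rewrite -cos0 ltr_cos ?in_itv /=; have := @pi_gt0 R; lra.
pose q n r := (step_poly b n).[cos (w * r - w * m)].
pose arg r := (1 + cos (w * r - w * m)) / (2 * b).
have argitv r : 0 <= arg r <= 1.
  have h1 := cos_geN1 (w * r - w * m); have h2 := cos_le1 (w * r - w * m).
  rewrite /arg divr_ge0/=; [|by lra|by rewrite /b; lra].
  by rewrite ler_pdivrMr /b; lra.
have fq n : mu.-integrable D (EFin \o (fun r => f r * q n r)) /\
    Rintegral mu D (fun r => f r * q n r) = 0.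
  have [h1 h2] := trig_orthogonal_horner (- (w * m)) (step_poly b n) fi fo.
  split => //; rewrite -[RHS](h2 0 0); apply: eq_Rintegral => r _.
  by rewrite !mul0r addr0 cos0 mulr1.
have fI : f \_ I = fun r => f r * \1_I r.
  by apply/funext => r; rewrite patchE indicE; case: ifP => _; rewrite ?mulr1 ?mulr0.
have := @dominated_convergence _ _ R mu D mD
  (fun n => EFin \o (fun r => f r * q n r)) (EFin \o (f \_ I))
  (abse \o (EFin \o f)).
case.
- by move=> n; exact: measurable_int (fq n).1.
- apply/measurable_EFinP; rewrite fI; apply: measurable_funM.
    by have /measurable_EFinP := measurable_int mu fi.
  exact: measurable_indic.
(* At [u] and [v] the cosine sits on the threshold; so it does at 0 when [v = T], both being one
   point of the circle. *)
- exists ([set 0] `|` [set u] `|` [set v]); split.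
  + by apply: measurableU; [apply: measurableU|]; exact: measurable_set1.
  + by rewrite !null_set_setU//; (try exact: lebesgue_measure_set1);
      (try apply: measurableU); exact: measurable_set1.
  move=> r /=; apply: contra_notP => /not_orP[/not_orP[r0 ru] rv] Dr.
  apply: cvg_EFin; first exact: nearW.
  rewrite /= fI; apply: cvgM; first exact: cvg_cst.
  rewrite (_ : (fun n => q n r) = step_seq (arg r)); last first.
    by apply/funext => n; rewrite /q step_polyE.
  move: Dr; rewrite /= in_itv /= => /andP[r0' rT].
  have {r0}r0 : 0 < r by rewrite lt_neqAle r0' andbT; apply/eqP => h; apply: r0.
  rewrite indicE; case: (boolP (r \in I)); rewrite /I mem_setE in_itv /= => rI.
    apply: step_seq_cvg1; rewrite (andP (argitv r)).2 andbT.
    rewrite ltr_pdivlMr ?/b; last by lra.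
    suff : cos th < cos (w * r - w * m) by lra.
    rewrite -(cos_norm (w * r - w * m)) -mulrBr normrM gtr0_norm//.
    have h : `|r - m| < (v - u) / 2 by rewrite ltr_norml /m; lra.
    have h' : w * `|r - m| < th by rewrite ltr_pM2l.
    rewrite ltr_cos ?in_itv /=; [by []|..]; last by have := @pi_gt0 R; lra.
    by rewrite mulr_ge0 ?(ltW w0)//=; have := @pi_gt0 R; lra.
  apply: step_seq_cvg0; rewrite (andP (argitv r)).1/=.
  rewrite ltr_pdivrMr ?/b; last by lra.
  suff : cos (w * r - w * m) < cos th by lra.
  rewrite -(cos_norm (w * r - w * m)) -mulrBr normrM gtr0_norm//.
  have rI' : r < u \/ v < r.
    case: (ltgtP r u) => [|ur|/ru//]; first by left.
    case: (ltgtP r v) => [rv'||/rv//]; last by right.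
    by move: rI; rewrite ur rv'.
  have h1 : (v - u) / 2 < `|r - m|.
    by rewrite lter_normr /m; case: rI' => ?; apply/orP; [right|left]; lra.
  have h2 : `|r - m| < T - (v - u) / 2.
    by rewrite ltr_norml /m; case: rI' => ?; lra.
  apply: cos_lt_cos; first by have := @pi_gt0 R; lra.
  by rewrite /th ltr_pM2l// h1 -wT -mulrBr ltr_pM2l.
- exact: integrable_abse.
- apply: aeW => r n _ /=; rewrite lee_fin normrM.
  rewrite ler_piMr// ger0_norm /q step_polyE.
    by have /andP[] := step_seq_itv n (argitv r).
  by have /andP[] := step_seq_itv n (argitv r).
move=> Ii _; rewrite -[X in _ --> X -> _]EFin_Rintegral// => h.
have ID : D `&` I = I.
  apply/seteqP; split => [x []//|x Ix]; split => //; move: Ix.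
  rewrite /I /= !in_itv /= => /andP[ux xv].
  by rewrite (le_trans u0 (ltW ux)) (lt_le_trans xv vT).
rewrite -/I -ID Rintegral_mkcondr.
have h0 : (fun n => (0 : R)%:E) @ \oo --> (Rintegral mu D (f \_ I))%:E.
  apply: cvg_trans h; apply: near_eq_cvg; apply: nearW => n /=.
  by have := EFin_Rintegral mD (fq n).1; rewrite (fq n).2.
by apply: EFin_inj; apply: cvg_unique h0 (cvg_cst _); exact: ereal_hausdorff.
Qed.


(** A segment longer than half a period is cut at [T / 2], as the arc argument covers at most half a
    period. *)
Lemma trig_orthogonal_initial (f : R -> R) (x : R) :
  mu.-integrable D (EFin \o f) -> trig_orthogonal T f ->
  0 < x < T -> Rintegral mu `[0, x] f = 0.
Proof.
move=> fi fo /andP[x0 xT].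
have sub (i : interval R) : {subset i <= `[0, T[%R} ->
    mu.-integrable [set` i] (EFin \o f).
  move=> h; apply: (integrableS mD) fi => //; exact: measurable_itv.
have z (u v : R) : 0 <= u -> u < v -> v < T -> v - u <= T / 2 ->
    Rintegral mu `]u, v] f = 0.
  move=> u0 uv vT vu; rewrite -Rintegral_itv_bndo_bndc.
    by apply: trig_orthogonal_itv => //; exact: ltW.
  apply: sub => r; rewrite !in_itv /= => /andP[ur rv].
  by rewrite (le_trans u0 (ltW ur)) (lt_trans rv vT).
rewrite -Rintegral_itv_obnd_cbnd; last first.
  apply: sub => r; rewrite !in_itv /= => /andP[r0 rx].
  by rewrite ltW//= (le_lt_trans rx).
have [xh|hx] := leP x (T / 2); first by apply: z => //; lra.
have := @Rintegral_itvB R f (BRight 0) (BRight x) (T / 2).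
rewrite (z 0 (T / 2)) ?(z (T / 2) x) ?subr0; [|lra..].
apply; rewrite ?bnd_simp; [|lra..].
apply: sub => r; rewrite !in_itv /= => /andP[r0 rx].
by rewrite ltW//= (le_lt_trans rx).
Qed.

(** The primitive of [f] extended by zero vanishes on the open period, and Lebesgue differentiation
    returns [f] as its derivative almost everywhere. *)
Theorem trig_orthogonal_ae0 (f : R -> R) :
  mu.-integrable D (EFin \o f) -> trig_orthogonal T f ->
  {ae mu, forall r, D r -> f r = 0}.
Proof.
move=> fi fo; pose g := f \_ D.
have gi : mu.-integrable setT (EFin \o g).
  by rewrite -restrict_EFin; apply: (proj1 (integrable_mkcond _ mD)).
have gloc : locally_integrable setT g by exact: integrable_locally.
have giy y : mu.-integrable `]-oo, y] (EFin \o g) by exact: integrableST.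
have := FTC1Ny giy gloc; set F := fun x : R => _ => Fg.
have F0 x : 0 < x < T -> F x = 0.
  move=> xT; rewrite -(trig_orthogonal_initial fi fo xT).
  rewrite /F Rintegral_mkcond [RHS]Rintegral_mkcond; congr Rintegral.
  apply/funext => r; rewrite /g !patchE !mem_setE !in_itv /=.
  move: xT => /andP[x0 xT].
  case: (leP 0 r) => r0 /=; last by rewrite if_same.
  by case: (leP r x) => //= rx; rewrite (le_lt_trans rx xT).
have ae0 : {ae mu, forall r : measurableTypeR R, r != 0}.
  exists [set 0]; split; [exact: measurable_set1|exact: lebesgue_measure_set1|].
  by move=> r /= /negP; rewrite negbK => /eqP.
have fil := @ae_filter_ringOfSetsType _ _ R mu.
apply: filterS (@filterI _ _ fil _ _ Fg ae0) => r [[_ Fr] r0] Dr.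
have rT : 0 < r < T.
  by move: Dr; rewrite /= in_itv /= => /andP[h ->]; rewrite lt_neqAle eq_sym r0 h.
rewrite -[LHS](_ : g r = f r); last by rewrite /g patchE mem_set.
rewrite -Fr derive1E (@near_eq_derive _ _ _ _ (cst 0)) ?derive_cst//.
near=> x; apply: F0.
have : x \in `]0, T[ by near: x; apply: near_in_itvoo; rewrite in_itv.
by rewrite in_itv.
Unshelve. all: by end_near. Qed.

End fourier_uniqueness_ae.

(** * Fourier coefficients and the Dirichlet kernel *)

Section fourier_coefficients.
Context {R : realType}.
Local Notation mu := (@lebesgue_measure R).

Lemma integrableZ_fct (A : set (measurableTypeR R)) (f : R -> R) (c : R) :
  measurable A -> mu.-integrable A (EFin \o f) ->
  mu.-integrable A (EFin \o (fun r => c * f r)).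
Proof.
by move=> mA fi; apply: eq_integrable (integrableZl mA c fi) => // x _ /=; rewrite -EFinM.
Qed.

Lemma integrableB_fct (A : set (measurableTypeR R)) (f g : R -> R) :
  measurable A -> mu.-integrable A (EFin \o f) -> mu.-integrable A (EFin \o g) ->
  mu.-integrable A (EFin \o (fun r => f r - g r)).
Proof.
by move=> mA fi gi; apply: eq_integrable (integrableB mA fi gi) => // x _ /=; rewrite -EFinB.
Qed.

Lemma integrable_sum_fct (A : set (measurableTypeR R)) (J : Type) (s : seq J)
    (F : J -> R -> R) : measurable A ->
  (forall j, mu.-integrable A (EFin \o F j)) ->
  mu.-integrable A (EFin \o (fun r => \sum_(j <- s) F j r)).
Proof.
move=> mA Fi.
have := @integrable_sum _ _ R mu A mA J s xpredT (fun j => EFin \o F j) (fun j _ => Fi j).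
by apply: eq_integrable => // x _ /=; rewrite sumEFin.
Qed.

Lemma Rintegral_sum (A : set (measurableTypeR R)) (J : Type) (s : seq J)
    (F : J -> R -> R) : measurable A ->
  (forall j, mu.-integrable A (EFin \o F j)) ->
  Rintegral mu A (fun r => \sum_(j <- s) F j r) = \sum_(j <- s) Rintegral mu A (F j).
Proof.
move=> mA Fi; elim: s => [|j s IH].
  rewrite big_nil (_ : (fun _ => _) = cst 0) ?Rintegral_cst ?mul0r//.
  by apply/funext => r; rewrite big_nil.
rewrite big_cons -IH -RintegralD//; last exact: integrable_sum_fct.
by congr Rintegral; apply/funext => r; rewrite big_cons.
Qed.

Lemma cosD2pi_int (x : R) (n : int) : cos (x + n%:~R * (2 * pi)) = cos x.
Proof.
have nat_case (m : nat) y : cos (y + m%:R * (2 * pi)) = cos y :> R.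
  by rewrite mulr_natl mulr_natl (periodicn (@cosD2pi R) m y).
case: n => m; first exact: nat_case.
by rewrite -[LHS](nat_case m.+1) NegzE; congr cos; ring.
Qed.

Lemma integrableM_sin (A : set (measurableTypeR R)) (f : R -> R) (k s : R) :
  measurable A -> mu.-integrable A (EFin \o f) ->
  mu.-integrable A (EFin \o (fun r => f r * sin (k * r + s))).
Proof.
move=> mA fi; apply: eq_integrable (integrableM_cos k (s - pi / 2) mA fi) => // x _ /=.
by rewrite addrA cosBpihalf.
Qed.

(** This is the real part of [e^(jB)] times the conjugate of the transform; a phase replaces complex
    exponentials, so integrals stay real. *)
Lemma Rintegral_cos_FT (f : R -> R) (W B : R) : abs_integrable f ->
  Rintegral mu setT (fun s => f s * cos (W * s + B)) =
  FT_re f W * cos B + FT_im f W * sin B.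
Proof.
move=> fi; rewrite /FT_re /FT_im.
have c0 : (fun s => f s * cos (W * s)) = (fun s => f s * cos (W * s + 0)).
  by apply/funext => s; rewrite addr0.
have s0 : (fun s => f s * sin (W * s)) = (fun s => f s * sin (W * s + 0)).
  by apply/funext => s; rewrite addr0.
have mT : measurable [set: measurableTypeR R] by exact: measurableT.
have ci : mu.-integrable setT (EFin \o (fun s => f s * cos (W * s))).
  by rewrite c0; exact: integrableM_cos.
have si : mu.-integrable setT (EFin \o (fun s => f s * sin (W * s))).
  by rewrite s0; exact: integrableM_sin.
rewrite mulNr -!RintegralZr// -RintegralB//; last 2 first.
- by apply: eq_integrable (integrableZ_fct (cos B) mT ci) => // x _ /=; rewrite mulrC.
- by apply: eq_integrable (integrableZ_fct (sin B) mT si) => // x _ /=; rewrite mulrC.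
by congr Rintegral; apply/funext => s; rewrite cosD; ring.
Qed.

Variable T : R.
Hypothesis T0 : 0 < T.
Local Notation D := (`[0, T[%classic : set (measurableTypeR R)).
Local Notation w := (omega0 T).

Let mD : measurable D. Proof. by []. Qed.

Let muD : mu D = T%:E.
Proof. by rewrite lebesgue_measure_itv /= lte_fin T0 oppr0 adde0. Qed.

Lemma integrable_cos_affine (k s : R) :
  mu.-integrable D (EFin \o (fun r => cos (k * r + s))).
Proof.
have muDoo : (mu D < +oo)%E by rewrite muD ltry.
apply: measurable_bounded_integrable => //.
- exact: measurable_cos_affine.
- exists 1; split; first exact: num_real.
  move=> M M1 r _; rewrite /= (le_trans _ (ltW M1))// ler_norml.
  by rewrite cos_geN1 cos_le1.
Qed.

Lemma Rintegral_period_cos (n : int) (s : R) :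
  Rintegral mu D (fun r => cos (n%:~R * w * r + s)) = T * cos s *+ (n == 0).
Proof.
have ci := integrable_cos_affine (n%:~R * w) s.
have [->|n0] := eqVneq n 0.
  rewrite mulr1n (_ : (fun _ => _) = cst (cos s)); last first.
    by apply/funext => r /=; rewrite !mul0r add0r.
  rewrite Rintegral_cst//; transitivity (cos s * fine (mu D)) => //.
  by rewrite muD mulrC.
rewrite mulr0n Rintegral_itv_bndo_bndc//.
pose W := n%:~R * w.
have W0 : W != 0 by rewrite mulf_neq0 ?intr_eq0// gt_eqF// omega0_gt0.
pose F r := W^-1 * sin (W * r + s).
have dF (r : R) : is_derive r 1 F (cos (W * r + s)).
  rewrite /F.
  have h : is_derive r 1 (fun r : R => W * r + s) W.
    by apply: is_derive_eq; rewrite addr0 /GRing.scale /= mulr1.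
  by apply: is_derive_eq; rewrite /GRing.scale /= mulrCA mulVf ?mulr1.
have cF : continuous F.
  move=> r; apply: differentiable_continuous; apply/derivable1_diffP.
  by have [] := dF r.
rewrite /Rintegral (@continuous_FTC2 _ _ F)//.
- rewrite /= /F mulr0 add0r.
  have -> : sin (W * T + s) = sin s.
    rewrite -!cosBpihalf -(cosD2pi_int (s - _) n); congr cos.
    by rewrite -(omega0M T0) /W; ring.
  by rewrite subrr.
- apply: continuous_subspaceT => r.
  by apply: continuous_comp; [apply: continuousD; [apply: continuousM;
    [exact: cvg_cst|]|exact: cvg_cst]|exact: continuous_cos].
- split; first by move=> r _; have [] := dF r.
    by apply: cvg_at_right_filter; exact: cF.
  by apply: cvg_at_left_filter; exact: cF.
- by move=> r _; rewrite derive1E; have [_ ->] := dF r.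
Qed.

(** Normalized to reproduce trigonometric polynomials of degree at most [K] over a period; cosines
    suffice, the sines of [k] and [-k] cancelling. *)
Definition dirichlet_kernel (K : nat) (t : R) : R :=
  T^-1 * \sum_(i < (2 * K).+1) cos ((i%:Z - K%:Z)%:~R * w * t).

Lemma integrable_dirichlet (K : nat) (t : R) :
  mu.-integrable D (EFin \o (fun r => dirichlet_kernel K (t - r))).
Proof.
apply: integrableZ_fct => //; apply: integrable_sum_fct => // i.
apply: eq_integrable (integrable_cos_affine (- ((i%:Z - K%:Z)%:~R * w)) ((i%:Z - K%:Z)%:~R * w * t)) => // r _ /=.
by congr (EFin (cos _)); ring.
Qed.

(** Product-to-sum leaves the frequencies [n - k] and [n + k]. Only [k = n] and [k = -n] survive
    integration, each with weight 1/2. *)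
Lemma Rintegral_dirichlet (K : nat) (t s : R) (n : int) :
  Rintegral mu D (fun r => dirichlet_kernel K (t - r) * cos (n%:~R * w * r + s)) =
  cos (n%:~R * w * t + s) *+ (- (K%:Z) <= n <= K%:Z)%R.
Proof.
pose k (i : nat) : int := i%:Z - K%:Z.
have -> : (fun r => dirichlet_kernel K (t - r) * cos (n%:~R * w * r + s)) =
  (fun r => T^-1 * \sum_(i < (2 * K).+1)
     (2^-1 * (cos ((n - k i)%:~R * w * r + (k i)%:~R * w * t + s)) +
      2^-1 * (cos ((n + k i)%:~R * w * r + (s - (k i)%:~R * w * t))))).
  apply/funext => r; rewrite /dirichlet_kernel -[LHS]mulrA mulr_suml.
  congr (_ * _); apply: eq_bigr => i _; rewrite -/(k i) -addrA.
  have -> : (n - k i)%:~R * w * r + ((k i)%:~R * w * t + s) =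
    (n%:~R * w * r + s) + (k i)%:~R * w * (t - r) by ring.
  have -> : (n + k i)%:~R * w * r + (s - (k i)%:~R * w * t) =
    (n%:~R * w * r + s) - (k i)%:~R * w * (t - r) by ring.
  by rewrite [in RHS]cosD cosB; field.
have i1 (i : nat) : mu.-integrable D (EFin \o (fun r =>
    2^-1 * (cos ((n - k i)%:~R * w * r + (k i)%:~R * w * t + s)))).
  apply: integrableZ_fct => //; apply: eq_integrable (integrable_cos_affine
    ((n - k i)%:~R * w) ((k i)%:~R * w * t + s)) => // r _ /=.
  by rewrite addrA.
have i2 (i : nat) : mu.-integrable D (EFin \o (fun r =>
    2^-1 * (cos ((n + k i)%:~R * w * r + (s - (k i)%:~R * w * t))))).
  by apply: integrableZ_fct => //; exact: integrable_cos_affine.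
have i12 (i : nat) := integrableD mD (i1 i) (i2 i).
rewrite RintegralZl//; last first.
  apply: integrable_sum_fct => // i.
  by apply: eq_integrable (i12 i) => // r _ /=; rewrite -EFinD.
rewrite Rintegral_sum//; last first.
  move=> i; by apply: eq_integrable (i12 i) => // r _ /=; rewrite -EFinD.
have step (i : nat) : Rintegral mu D (fun r =>
    2^-1 * (cos ((n - k i)%:~R * w * r + (k i)%:~R * w * t + s)) +
    2^-1 * (cos ((n + k i)%:~R * w * r + (s - (k i)%:~R * w * t)))) =
    2^-1 * T * cos (n%:~R * w * t + s) *+ (k i == n) +
    2^-1 * T * cos (n%:~R * w * t + s) *+ (k i == - n).
  rewrite RintegralD// !RintegralZl//; [|exact: integrable_cos_affine|].
    under eq_Rintegral do rewrite -addrA.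
    rewrite !Rintegral_period_cos subr_eq0 addr_eq0 [n == k i]eq_sym.
    rewrite [n == - _]eq_sym eqr_oppLR; congr (_ + _).
      by case: eqP => [->|_]; rewrite ?mulr0n ?mulr0// !mulr1n mulrA.
    case: eqP => [->|_]; rewrite ?mulr0n ?mulr0// !mulr1n mulrA.
    by congr (_ * cos _); ring.
  apply: eq_integrable (integrable_cos_affine
    ((n - k i)%:~R * w) ((k i)%:~R * w * t + s)) => // r _ /=.
  by rewrite addrA.
under eq_bigr do rewrite step.
have count (m : int) (c : R) : \sum_(i < (2 * K).+1) c *+ (k i == m) =
    c *+ (- (K%:Z) <= m <= K%:Z)%R.
  case: (boolP (- (K%:Z) <= m <= K%:Z)) => mK.
    have mi : (absz (m + K%:Z)%R < (2 * K).+1)%N by lia.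
    rewrite (bigD1 (Ordinal mi)) //= big1 ?addr0 => [|i /eqP im].
      by rewrite (_ : _ == _)//; rewrite /k; apply/eqP; lia.
    rewrite (_ : _ == _ = false)//; apply/negbTE/eqP => km; apply: im.
    by apply/val_inj => /=; move: km; rewrite /k; lia.
  rewrite big1// => i _; rewrite (_ : _ == _ = false)//; apply/negbTE/eqP.
  by move: mK; have := ltn_ord i; rewrite /k; lia.
rewrite big_split /= !count.
have -> : (- (K%:Z) <= - n <= K%:Z) = (- (K%:Z) <= n <= K%:Z) by lia.
have T1 : T != 0 by rewrite gt_eqF.
by case: (_ <= n <= _); rewrite ?mulr0n ?mulr1n; field.
Qed.

End fourier_coefficients.

(** * The filtered signal as a trigonometric polynomial *)

Section filtered_signal.
Context {R : realType}.
Local Notation mu := (@lebesgue_measure R).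
Variable T : R.
Hypothesis T0 : 0 < T.
Local Notation D := (`[0, T[%classic : set (measurableTypeR R)).
Local Notation w := (omega0 T).

Let mD : measurable D. Proof. by []. Qed.

(** Periodicity is asked only along the orbit of [t], because [x] will be known to be periodic only
    at almost every point. *)
Lemma psumM_periodic (f e : R -> R) N t :
  (forall n : int, e (t + n%:~R * T) = e t) ->
  psum T (fun r => f r * e r) N t = psum T f N t * e t.
Proof.
move=> et; rewrite /psum mulr_suml; apply: eq_bigr => i _; congr (_ * _).
by rewrite -[RHS](et (N%:Z - i%:Z)); congr e; ring.
Qed.

Lemma cos_omega0_periodic (k n : int) (s t : R) :
  cos (k%:~R * w * (t + n%:~R * T) + s) = cos (k%:~R * w * t + s).
Proof.
rewrite -[RHS](cosD2pi_int _ (k * n)); congr cos.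
by rewrite -(omega0M T0); ring.
Qed.

(** A cosine at a multiple of [w] is [T]-periodic and factors out of the periodization; integrals
    over a period thus become values of a Fourier transform. *)
Lemma Rintegral_periodization_cos (f F : R -> R) (k : int) (s : R) :
  mu.-integrable setT (EFin \o f) -> measurable_fun D F ->
  {ae mu, forall t, D t -> psum T f ^~ t @ \oo --> F t} ->
  Rintegral mu D (fun r => F r * cos (k%:~R * w * r + s)) =
  Rintegral mu setT (fun r => f r * cos (k%:~R * w * r + s)).
Proof.
move=> fi mF fF.
have mT : measurable [set: measurableTypeR R] by exact: measurableT.
apply: (periodization T0 _ _ _).2.
- exact: integrableM_cos.
- by apply: measurable_funM => //; exact: measurable_cos_affine.
- apply: filterS fF => t /[apply] ft.
  rewrite (_ : (fun N => _) = (fun N => psum T f N t * cos (k%:~R * w * t + s))).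
    by apply: cvgM => //; exact: cvg_cst.
  apply/funext => N; apply: psumM_periodic => n.
  exact: cos_omega0_periodic.
Qed.

(** A shift by [T] preserves the limit once the end terms tend to 0. This decay, [P], holds at [t]
    by absolute boundedness and is itself invariant under shifts both ways, so induction covers all
    integers. *)
Lemma psum_lim_periodic (f x : R -> R) t M :
  (forall s, psum T f ^~ s @ \oo --> x s) ->
  (forall N, psum T (Num.norm \o f) N t <= M) ->
  forall n : int, x (t + n%:~R * T) = x t.
Proof.
move=> fx fM.
pose P s := ((fun n : nat => f (s + n%:R * T)) @ \oo --> (0 : R)) /\
  ((fun n : nat => f (s - n%:R * T)) @ \oo --> (0 : R)).
have Pstep s : P s -> x (s + T) = x s.
  move=> [h1 h2]; have h : psum T f ^~ (s + T) @ \oo --> x s + 0 - 0.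
    rewrite (_ : (fun N => _) = (fun N => psum T f N s + f (s + N.+1%:R * T) - f (s - N%:R * T))).
      apply: cvgB => //; apply: cvgD => //.
      by rewrite (cvg_shiftS (fun n : nat => f (s + n%:R * T))).
    by apply/funext => N; exact: psum_addT.
  by rewrite -[LHS](cvg_lim _ (fx (s + T)))// (cvg_lim _ h)// addr0 subr0.
have PDT s : P s -> P (s + T).
  move=> [h1 h2]; split.
    rewrite (_ : (fun n : nat => _) = (fun n : nat => f (s + n.+1%:R * T))).
      by rewrite (cvg_shiftS (fun n : nat => f (s + n%:R * T))).
    by apply/funext => n; congr f; ring.
  rewrite -cvg_shiftS (_ : [sequence _]_n = (fun n : nat => f (s - n%:R * T)))//.
  by apply/funext => n /=; congr f; ring.
have PBT s : P s -> P (s - T).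
  move=> [h1 h2]; split; last first.
    rewrite (_ : (fun n : nat => _) = (fun n : nat => f (s - n.+1%:R * T))).
      by rewrite (cvg_shiftS (fun n : nat => f (s - n%:R * T))).
    by apply/funext => n; congr f; ring.
  rewrite -cvg_shiftS (_ : [sequence _]_n = (fun n : nat => f (s + n%:R * T)))//.
  by apply/funext => n /=; congr f; ring.
have Pt : P t by exact: psum_terms_cvg0 fM.
have pos (m : nat) : P (t + m%:R * T) /\ x (t + m%:R * T) = x t.
  elim: m => [|m [IHP IHx]]; first by rewrite mul0r addr0.
  have -> : t + m.+1%:R * T = t + m%:R * T + T by ring.
  by split; [exact: PDT|rewrite Pstep].
have neg (m : nat) : P (t - m%:R * T) /\ x (t - m%:R * T) = x t.
  elim: m => [|m [IHP IHx]]; first by rewrite mul0r subr0.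
  have -> : t - m.+1%:R * T = t - m%:R * T - T by ring.
  by split; [exact: PBT|rewrite -[LHS]Pstep ?subrK//; exact: PBT].
case=> m; first exact: (pos m).2.
by rewrite NegzE mulrNz mulNr; exact: (neg m.+1).2.
Qed.

(** The flip [r |-> t - r] turns the coefficient of [G] at [k] into the transform of [g] at [-k].
    The result matches [Rintegral_dirichlet] for every phase, so the difference is orthogonal to all
    cosines. *)
Lemma kernel_periodization (g G : R -> R) (K : nat) (t : R) :
  abs_integrable g ->
  (forall k : int, FT_eq_real g (k%:~R * w)
     (if (- (K%:Z) <= k <= K%:Z) then 1 else 0)) ->
  measurable_fun D G ->
  {ae mu, forall r, D r -> psum T (fun r => g (t - r)) ^~ r @ \oo --> G r} ->
  {ae mu, forall r, D r -> G r = dirichlet_kernel T K (t - r)}.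
Proof.
move=> gi gK mG gG.
have mp := measurable_flip t; have lp := @lebesgue_measure_ocitv_flip R t.
have mT : measurable [set: measurableTypeR R] by exact: measurableT.
have gti : mu.-integrable setT (EFin \o (fun r => g (t - r))).
  exact: (integrable_measure_preserving mp lp gi).
have [Gi _] := periodization T0 gti mG gG.
have Di := integrable_dirichlet T0 K t.
have Gcos (k : int) s : Rintegral mu D (fun r => G r * cos (k%:~R * w * r + s)) =
    cos (k%:~R * w * t + s) *+ (- (K%:Z) <= k <= K%:Z)%R.
  rewrite (Rintegral_periodization_cos _ _ gti)//.
  pose gk r := g r * cos ((- k)%:~R * w * r + (k%:~R * w * t + s)).
  have gki : mu.-integrable setT (EFin \o gk) by exact: integrableM_cos.
  have := Rintegral_measure_preserving mp lp gki.
  rewrite /gk Rintegral_cos_FT//; have [-> ->] := gK (- k).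
  rewrite mul0r addr0 => h.
  rewrite -[LHS](_ : Rintegral mu setT (gk \o (fun r => t - r)) = _).
    rewrite h; have -> : (- (K%:Z) <= - k <= K%:Z) = (- (K%:Z) <= k <= K%:Z) by lia.
    by case: ifP; rewrite ?mul1r ?mul0r.
  by apply: eq_Rintegral => r _; rewrite /gk /=; congr (_ * cos _); ring.
have h0 := @trig_orthogonal_ae0 R T T0 (fun r => G r - dirichlet_kernel T K (t - r)).
have : mu.-integrable D (EFin \o (fun r => G r - dirichlet_kernel T K (t - r))).
  exact: integrableB_fct.
move=> /h0; case.
- move=> k s; under eq_Rintegral do rewrite mulrBl.
  rewrite RintegralB//; [|exact: integrableM_cos..].
  by rewrite Gcos Rintegral_dirichlet// subrr.
move=> N [mN N0 sN]; exists N; split => // r /= nr; apply: sN => /= h; apply: nr => Dr.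
by apply/eqP; rewrite -subr_eq0 h.
Qed.

(* Unfolding the convolution over the periods replaces [g] by its
   periodization, which is the Dirichlet kernel. *)
Lemma filtered_FRI_signal (L K : nat) (h g x : R -> R) (a tau : 'I_L -> R) (t : R) :
  abs_integrable h -> abs_integrable g ->
  (forall k : int, FT_eq_real g (k%:~R * w)
     (if (- (K%:Z) <= k <= K%:Z) then 1 else 0)) ->
  FRI_signal T h a tau x -> conv_defined x g ->
  convol x g t = T^-1 * \sum_(i < (2 * K).+1) \sum_(l < L) a l *
    (FT_re h ((i%:Z - K%:Z)%:~R * w) * cos ((i%:Z - K%:Z)%:~R * w * (t - tau l)) -
     FT_im h ((i%:Z - K%:Z)%:~R * w) * sin ((i%:Z - K%:Z)%:~R * w * (t - tau l))).
Proof.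
move=> hi gi gK hx xgi.
have mT : measurable [set: measurableTypeR R] by exact: measurableT.
(* One packet of pulses; [x] is its periodization, which yields measurability of [x] and its Fourier
   coefficients. *)
pose phi r := \sum_(l < L) a l * h (r - tau l).
have hli (l : 'I_L) : mu.-integrable setT (EFin \o (fun r => h (r - tau l))).
  exact: integrable_shift.
have phii : mu.-integrable setT (EFin \o phi).
  by apply: integrable_sum_fct => // l; exact: integrableZ_fct.
have phix s : psum T phi ^~ s @ \oo --> x s.
  apply: cvg_trans (hx s); apply: near_eq_cvg; apply: nearW => N.
  rewrite /psum /phi; apply: eq_bigr => i _; apply: eq_bigr => l _.
  by congr (_ * h _); ring.
have mx : measurable_fun setT x.
  apply: (measurable_fun_cvg (h := psum T phi)) => [N|r _]; last exact: phix.
  by have /measurable_EFinP := measurable_int mu (integrable_psum T N phii).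
have phixD : {ae mu, forall r, D r -> psum T phi ^~ r @ \oo --> x r}.
  by apply: aeW => r _; exact: phix.
have mxD : measurable_fun D x by exact: measurable_funTS.
have [xi _] := periodization T0 phii mxD phixD.
have xcos (k : int) s : Rintegral mu D (fun r => x r * cos (k%:~R * w * r + s)) =
    \sum_(l < L) a l * (FT_re h (k%:~R * w) * cos (k%:~R * w * tau l + s) +
       FT_im h (k%:~R * w) * sin (k%:~R * w * tau l + s)).
  rewrite (Rintegral_periodization_cos _ _ phii)//.
  have -> : (fun r => phi r * cos (k%:~R * w * r + s)) = (fun r =>
     \sum_(l < L) a l * (h (r - tau l) * cos (k%:~R * w * r + s))).
    by apply/funext => r; rewrite mulr_suml; apply: eq_bigr => l _; rewrite mulrA.
  have hlc l : mu.-integrable setT (EFin \o (fun r => h (r - tau l) * cos (k%:~R * w * r + s))).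
    exact: integrableM_cos.
  rewrite Rintegral_sum//; last by move=> l; exact: integrableZ_fct.
  apply: eq_bigr => l _; rewrite RintegralZl//; congr (_ * _).
  rewrite -Rintegral_cos_FT//.
  pose hk r := h r * cos (k%:~R * w * r + (k%:~R * w * tau l + s)).
  have hki : mu.-integrable setT (EFin \o hk) by exact: integrableM_cos.
  rewrite -(Rintegral_measure_preserving (measurable_shift (- tau l)) (@lebesgue_measure_ocitv_shift _ _) hki).
  by apply: eq_Rintegral => r _; rewrite /hk /=; congr (_ * cos _); ring.
have gti : mu.-integrable setT (EFin \o (fun r => g (t - r))).
  exact: (integrable_measure_preserving (measurable_flip t) (@lebesgue_measure_ocitv_flip R t) gi).
have [G mG gG] := periodization_exists T0 gti.
have GD := kernel_periodization gi gK mG gG.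
have phib := psum_normr_bounded_ae T0 phii.
have fil := @ae_filter_ringOfSetsType _ _ R mu.
(* [x] leaves the sum over the orbit of [r] wherever the sums of [|phi|] are bounded, since it is
   periodic there. *)
have xgG : {ae mu, forall r, D r ->
    psum T (fun s => x s * g (t - s)) ^~ r @ \oo --> x r * G r}.
  apply: filterS (@filterI _ _ fil _ _ gG phib) => r [gr phr] Dr.
  have [M phM] := phr Dr.
  rewrite (_ : (fun N => _) = (fun N => psum T (fun s => g (t - s)) N r * x r)).
    by rewrite [x r * _]mulrC; apply: cvgM; [exact: gr|exact: cvg_cst].
  apply/funext => N; rewrite -psumM_periodic.
    by congr (psum _ _ _ _); apply/funext => s; rewrite mulrC.
  exact: psum_lim_periodic phix phM.
have [xGi xG] := periodization T0 (xgi t) (measurable_funM mxD mG) xgG.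
rewrite /convol -xG.
pose k (i : nat) : int := i%:Z - K%:Z.
pose xc (i : nat) r := x r * cos ((k i)%:~R * w * r + - ((k i)%:~R * w * t)).
have xci (i : nat) : mu.-integrable D (EFin \o xc i) by exact: integrableM_cos.
have xDE : (fun r => x r * dirichlet_kernel T K (t - r)) =
    (fun r => T^-1 * \sum_(i < (2 * K).+1) xc i r).
  apply/funext => r; rewrite /dirichlet_kernel mulrCA mulr_sumr.
  congr (_ * _); apply: eq_bigr => i _; congr (_ * _).
  by rewrite -cosN; congr cos; rewrite /k; ring.
have xDi : mu.-integrable D (EFin \o (fun r => x r * dirichlet_kernel T K (t - r))).
  by rewrite xDE; apply: integrableZ_fct => //; apply: integrable_sum_fct => // i.
transitivity (Rintegral mu D (fun r => x r * dirichlet_kernel T K (t - r))).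
  rewrite /Rintegral; congr fine; apply: ae_eq_integral => //.
  - by have /(measurable_int mu) := xGi.
  - by have /(measurable_int mu) := xDi.
  - by apply: filterS GD => r /[apply] /= ->.
rewrite xDE RintegralZl//; last by apply: integrable_sum_fct => // i.
rewrite Rintegral_sum//; congr (_ * _); apply: eq_bigr => i _.
rewrite /xc xcos; apply: eq_bigr => l _; congr (_ * _).
rewrite -/(k i) -[in RHS]cosN -(opprK (sin (_ * (t - tau l)))) -sinN mulrN opprK.
by congr (_ * cos _ + _ * sin _); ring.
Qed.

End filtered_signal.

(** * Uniqueness for the Prony system *)

Section prony.

Lemma moments_horner (F : fieldType) (n N : nat) (a v : 'I_n -> F) (p : {poly F}) :
  (size p <= N)%N ->
  \sum_(l < n) a l * p.[v l] =
  \sum_(i < N) p`_i * \sum_(l < n) a l * v l ^+ i.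
Proof.
move=> pN; under [RHS]eq_bigr do rewrite mulr_sumr.
rewrite exchange_big /=; apply: eq_bigr => l _.
by rewrite (horner_coef_wide _ pN) mulr_sumr; apply: eq_bigr => i _; rewrite mulrCA.
Qed.

(* Test the moments against the polynomial vanishing at all nodes but [v' l]. *)
Lemma moments_determine (F : fieldType) (n N : nat) (a a' v v' : 'I_n -> F) :
  (2 * n <= N)%N -> injective v -> injective v' ->
  (forall l, a' l != 0) ->
  (forall i, (i < N)%N -> \sum_(l < n) a l * v l ^+ i = \sum_(l < n) a' l * v' l ^+ i) ->
  forall l, exists2 m, v' l = v m & a' l = a m.
Proof.
move=> nN vi vi' a'0 mom l.
(* Both products spare [v' l]; at most [n] and [n - 1] roots keep the size within [2n]. *)
pose p := \prod_(m <- enum 'I_n | v m != v' l) ('X - (v m)%:P) *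
          \prod_(m <- enum 'I_n | m != l) ('X - (v' m)%:P).
have pN : (size p <= N)%N.
  apply: leq_trans nN; apply: leq_trans (size_polyMleq _ _) _.
  rewrite -!(big_filter (enum _)) !size_prod_XsubC /=.
  have h1 : (size [seq m <- enum 'I_n | v m != v' l] <= n)%N.
    by rewrite size_filter (leq_trans (count_size _ _))// size_enum_ord.
  have h2 : (size [seq m <- enum 'I_n | m != l] < n)%N.
    rewrite size_filter -[X in (_ < X)%N](size_enum_ord n).
    rewrite -(count_predC (fun m => m != l)) -[X in (X < _)%N]addn0 ltn_add2l.
    by rewrite -has_count; apply/hasP; exists l; rewrite ?mem_enum//= negbK.
  by rewrite mulSn mul1n leq_add.
have ev z : p.[z] = \prod_(m <- enum 'I_n | v m != v' l) (z - v m) *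
          \prod_(m <- enum 'I_n | m != l) (z - v' m).
  by rewrite hornerM !horner_prod; congr (_ * _); apply: eq_bigr => m _; rewrite hornerXsubC.
have pl : p.[v' l] != 0.
  rewrite ev mulf_neq0// prodf_seq_neq0; apply/allP => m _; apply/implyP.
    by rewrite subr_eq0 eq_sym.
  by move=> ml; rewrite subr_eq0; apply: contra ml => /eqP/vi' ->.
have pv m : v m != v' l -> p.[v m] = 0.
  move=> vm; rewrite ev (big_rem m) ?mem_enum//= vm subrr !mul0r//.
have pv' m : m != l -> p.[v' m] = 0.
  move=> ml; rewrite ev mulrC (big_rem m) ?mem_enum//= ml subrr !mul0r//.
have E : \sum_(m < n) a m * p.[v m] = a' l * p.[v' l].
  rewrite (moments_horner _ _ pN).
  under eq_bigr => i _ do rewrite (mom i (ltn_ord i)).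
  rewrite -(moments_horner _ _ pN) (bigD1 l)//= big1 ?addr0// => m ml.
  by rewrite pv' ?mulr0.
case: (pickP (fun m => v m == v' l)) => [m /eqP vm|none].
  exists m; first by rewrite vm.
  move: E; rewrite (bigD1 m)//= big1 ?addr0 => [|m' m'm].
    by rewrite vm => /(mulIf pl).
  by rewrite pv ?mulr0// -vm; apply: contra m'm => /eqP/vi ->.
(* If no [v m] meets [v' l], the left side of [E] vanishes while [a' l * p.[v' l]] does not. *)
move: E; rewrite big1 => [/esym/eqP|m _]; last by rewrite pv ?mulr0// none.
by rewrite mulf_eq0 (negbTE pl) orbF (negbTE (a'0 l)).
Qed.

End prony.

(** * Complex exponentials and zeros of trigonometric polynomials *)

Section cis.
Context {R : realType}.
Local Open Scope complex_scope.

Definition cis (t : R) : R[i] := cos t +i* sin t.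

Lemma cis0 : cis 0 = 1.
Proof. by rewrite /cis cos0 sin0. Qed.

Lemma cisD (s t : R) : cis (s + t) = cis s * cis t.
Proof.
rewrite /cis cosD sinD; apply/eqP; rewrite eq_complex /= eqxx /=.
by rewrite addrC.
Qed.

Lemma cisX (t : R) n : cis t ^+ n = cis (n%:R * t).
Proof.
elim: n => [|n IH]; first by rewrite mul0r cis0 expr0.
by rewrite exprS IH -cisD; congr cis; ring.
Qed.

Lemma cis_neq0 (t : R) : cis t != 0.
Proof.
apply/eqP => h; have : cis (t - t) = 0 by rewrite cisD h mul0r.
by rewrite subrr cis0 => /eqP; rewrite oner_eq0.
Qed.

Lemma cis_inj (s t : R) : `|s - t| < 2 * pi -> cis s = cis t -> s = t.
Proof.
move=> st E; apply/eqP; rewrite -subr_eq0 -normr_eq0; apply/negPn/negP => st0.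
have : cis (s - t) = 1 by rewrite cisD E -cisD subrr cis0.
move=> [+ _]; rewrite -cos_norm => c1.
have := @cos_lt_cos R 0 `|s - t|; rewrite c1 cos0 ltxx => h.
have : false; last by [].
by apply: h; rewrite ?pi_ge0 ?lexx//= subr0 st andbT lt_neqAle eq_sym st0 normr_ge0.
Qed.

Lemma sum_symmetric0 (K : nat) (f : int -> R) : (forall k, f (- k) = - f k) ->
  \sum_(i < (2 * K).+1) f (i%:Z - K%:Z) = 0.
Proof.
move=> fodd; have h : \sum_(i < (2 * K).+1) f (i%:Z - K%:Z) =
    - \sum_(i < (2 * K).+1) f (i%:Z - K%:Z).
  rewrite [LHS](reindex_inj rev_ord_inj) -sumrN; apply: eq_bigr => i _ /=.
  by rewrite -fodd; congr f; have := ltn_ord i; lia.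
lra.
Qed.

Definition trig_poly (K : nat) (c : int -> R[i]) (w t : R) : R[i] :=
  \sum_(i < (2 * K).+1) c (i%:Z - K%:Z) * cis ((i%:Z - K%:Z)%:~R * w * t).

(** Multiplied by [cis (K w t)], the sum is a polynomial of size at most 2K+1 in [cis (w t)]. Phases
    less than one turn apart make its 2K+1 roots distinct. *)
Lemma trig_poly_eq0 (K : nat) (c : int -> R[i]) (w : R) (s : nat -> R) :
  (forall i j, (i <= 2 * K)%N -> (j <= 2 * K)%N -> `|w * s i - w * s j| < 2 * pi) ->
  (forall i j, (i <= 2 * K)%N -> (j <= 2 * K)%N -> w * s i = w * s j -> i = j) ->
  (forall i, (i <= 2 * K)%N -> trig_poly K c w (s i) = 0) ->
  forall i, (i <= 2 * K)%N -> c (i%:Z - K%:Z) = 0.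
Proof.
move=> sb si s0 i iK.
pose p := \poly_(i < (2 * K).+1) c (i%:Z - K%:Z).
have p0 : p = 0.
  apply: (@roots_geq_poly_eq0 _ p [seq cis (w * s j) | j <- iota 0 (2 * K).+1]).
  - apply/allP => x /mapP[j + ->]; rewrite mem_iota add0n ltnS => /andP[_ jK].
    rewrite /root horner_poly; apply/eqP.
    apply: (mulfI (cis_neq0 (- (K%:R * (w * s j))))).
    rewrite mulr0 mulr_sumr -[RHS](s0 j jK); apply: eq_bigr => n _.
    by rewrite cisX mulrCA -cisD; congr (_ * cis _); ring.
  - rewrite map_inj_in_uniq ?iota_uniq// => j k; rewrite !mem_iota !add0n !ltnS.
    move=> /andP[_ jK] /andP[_ kK] /cis_inj; rewrite sb// => /(_ isT).
    exact: si.
  - by rewrite size_map size_iota size_poly.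
have := coef_poly (2 * K).+1 (fun i => c (i%:Z - K%:Z)) i.
by rewrite -/p p0 coef0 ltnS iK.
Qed.

End cis.

(** * Firing instants and zeros between them *)

Section firing.
Context {R : realType}.
Local Notation mu := (@lebesgue_measure R).

Lemma continuous_sum_fct (J : Type) (s : seq J) (F : J -> R -> R) :
  (forall j, continuous (F j)) -> continuous (fun t => \sum_(j <- s) F j t).
Proof.
move=> Fc; elim: s => [|j s IH].
  rewrite (_ : (fun _ => _) = cst 0); first by move=> x; exact: cvg_cst.
  by apply/funext => t; rewrite big_nil.
rewrite (_ : (fun _ => _) = F j \+ (fun t => \sum_(j <- s) F j t)).
  by move=> x; apply: continuousD; [exact: Fc|exact: IH].
by apply/funext => t; rewrite big_cons.
Qed.

Lemma continuous_integrable_itv (f : R -> R) (u v : R) :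
  continuous f -> mu.-integrable `[u, v] (EFin \o f).
Proof.
move=> fc; apply: continuous_compact_integrable; first exact: segment_compact.
exact: continuous_subspaceT.
Qed.

(** Rolle for the primitive, which vanishes at both ends. The root is interior, so roots from
    adjacent gaps differ. *)
Lemma Rintegral_eq0_root (f : R -> R) (u v : R) : u < v -> continuous f ->
  Rintegral mu `[u, v] f = 0 -> exists2 s, u < s < v & f s = 0.
Proof.
move=> uv fc f0.
pose F x := Rintegral mu `[u, x] f.
have dF x : u < x -> derivable F x 1 /\ derive1 F x = f x.
  move=> ux; have xx1 : x < x + 1 by rewrite ltrDl.
  by apply: (@continuous_FTC1_closed _ f u x (x + 1)) => //;
    [exact: continuous_integrable_itv|exact: fc].
have [|||s sI [_ ds]] := @derive.Rolle R F u v uv.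
- move=> x; rewrite in_itv /= => /andP[ux xv]; exact: (dF x ux).1.
- by apply: parameterized_integral_continuous; [exact: ltW|exact: continuous_integrable_itv].
- by rewrite /F f0 set_itv1 Rintegral_set1.
move: sI; rewrite in_itv /= => sI; exists s => //.
by have /andP[us _] := sI; rewrite -(dF s us).2 derive1E.
Qed.

Variables (b kappa delta : R).
Hypotheses (kappa0 : 0 < kappa) (delta0 : 0 < delta).

(** The integrand is at least [b - c], while its integral over a gap is [kappa * delta]. *)
Lemma iftem_gap (y : R -> R) (c t0 : R) (tn : nat -> R) :
  continuous y -> (forall t, `|y t| <= c) -> c < b ->
  iftem_instants y b kappa delta t0 tn ->
  forall n, tn n.+1 - tn n <= kappa * delta / (b - c).
Proof.
move=> yc yb cb [_ it] n; have [lt [eqd _]] := it n.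
have bc : 0 < b - c by rewrite subr_gt0.
have ybc : continuous (fun s => y s + b).
  by move=> s; apply: continuousD; [exact: yc|exact: cvg_cst].
have le : (b - c) * (tn n.+1 - tn n) <= Rintegral mu `[tn n, tn n.+1] (fun s => y s + b).
  have -> : (b - c) * (tn n.+1 - tn n) = Rintegral mu `[tn n, tn n.+1] (fun=> b - c).
    have muI : mu `[tn n, tn n.+1] = (tn n.+1 - tn n)%:E.
      by rewrite lebesgue_measure_itv /= lte_fin lt.
    rewrite Rintegral_cst//; congr (_ * _).
    by transitivity (fine (mu `[tn n, tn n.+1])) => //; rewrite muI.
  apply: le_Rintegral => //.
  - by apply: continuous_integrable_itv => s; exact: cvg_cst.
  - exact: continuous_integrable_itv.
  - by move=> s _; have := yb s; rewrite ler_norml => /andP[]; lra.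
rewrite ler_pdivlMr// mulrC (le_trans le)//.
by rewrite -eqd mulrC divfK// gt_eqF.
Qed.

Lemma iftem_instant_le (t0 G : R) (tn : nat -> R) : tn 0%N = t0 ->
  (forall n, tn n.+1 - tn n <= G) -> forall n, tn n <= t0 + n%:R * G.
Proof.
move=> <- gap; elim=> [|n IH]; first by rewrite mul0r addr0.
by have := gap n; rewrite -natr1 mulrDl mul1r; lra.
Qed.

Lemma increasing_lt (tn : nat -> R) : (forall n, tn n < tn n.+1) ->
  {mono tn : m n / (m < n)%N >-> m < n}.
Proof. by move=> inc; apply: leW_mono; apply: le_mono; apply: homo_ltn => //; exact: lt_trans. Qed.

(** Only sets of instants are compared, and induction recovers the indexing: the next instant of
    either sequence occurs in the other beyond index [n], hence not before its own next instant. *)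
Lemma same_instants_eq (t0 T : R) (N : nat) (tn tn' : nat -> R) :
  (forall n, tn n < tn n.+1) -> (forall n, tn' n < tn' n.+1) ->
  tn 0%N = t0 -> tn' 0%N = t0 ->
  tn N <= t0 + T -> tn' N <= t0 + T ->
  same_instants_in t0 T tn tn' ->
  forall n, (n <= N)%N -> tn n = tn' n.
Proof.
move=> inc inc' t00 t00' tN tN' same.
have step (u v : nat -> R) n : (forall n, u n < u n.+1) -> (forall n, v n < v n.+1) ->
    u 0%N = t0 -> v N <= t0 + T -> (n < N)%N -> u n = v n ->
    (forall s, t0 <= s <= t0 + T -> (exists n, v n = s) -> exists n, u n = s) ->
    u n.+1 <= v n.+1.
  move=> iu iv u0 vN nN uvn sub.
  have lu := increasing_lt iu; have lv := increasing_lt iv.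
  have [|m um] := sub (v n.+1) _ (ex_intro _ n.+1 erefl).
    apply/andP; split.
      rewrite -u0 (@le_trans _ _ (u n))//; last by rewrite uvn ltW.
      by rewrite leNgt lu.
    by apply: le_trans vN; rewrite leNgt lv -leqNgt.
  have nm : (n < m)%N by rewrite -lu um uvn.
  by rewrite -um leNgt lu -leqNgt.
elim=> [|n IH] nN; first by rewrite t00 t00'.
have e := IH (ltnW nN).
apply/eqP; rewrite eq_le; apply/andP; split.
  by apply: step => // s sI; case: (same s sI).
by apply: step => // s sI; case: (same s sI).
Qed.

End firing.

(** * From the spectrum to the parameters *)

Section signal_spectrum.
Context {R : realType}.
Local Open Scope complex_scope.

Lemma sum_Complex (J : Type) (s : seq J) (f g : J -> R) :
  \sum_(j <- s) (f j +i* g j) = (\sum_(j <- s) f j) +i* (\sum_(j <- s) g j).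
Proof.
by elim: s => [|j s IH]; rewrite ?big_nil// !big_cons IH; apply/eqP; rewrite eq_complex /= !eqxx.
Qed.

Lemma FT_reN (f : R -> R) (W : R) : FT_re f (- W) = FT_re f W.
Proof.
by rewrite /FT_re; congr Rintegral; apply/funext => t; rewrite mulNr cosN.
Qed.

Lemma FT_imN (f : R -> R) (W : R) : abs_integrable f -> FT_im f (- W) = - FT_im f W.
Proof.
move=> fi; have mT : measurable [set: measurableTypeR R] by exact: measurableT.
have si : lebesgue_measure.-integrable setT (EFin \o (fun t => f t * sin (- W * t))).
  by apply: eq_integrable (integrableM_sin (- W) 0 mT fi) => // t _ /=; rewrite addr0.
rewrite /FT_im opprK -[LHS]mulN1r -RintegralZl//.
by congr Rintegral; apply/funext => t; rewrite mulN1r mulNr sinN mulrN opprK.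
Qed.

Definition FT (f : R -> R) (W : R) : R[i] := FT_re f W +i* FT_im f W.

(* [T] times the Fourier coefficients of the filtered signal. *)
Definition spectrum (T : R) (L : nat) (h : R -> R) (a tau : 'I_L -> R) (k : int) : R[i] :=
  FT h (k%:~R * omega0 T) * \sum_(l < L) (a l)%:C * cis (- (k%:~R * omega0 T * tau l)).

(** For real [h] the real part of the transform is even and the imaginary part odd, so the imaginary
    parts [B] are odd in the frequency and cancel in the symmetric sum. *)
Lemma signal_trig_poly (T : R) (L K : nat) (h : R -> R) (a tau : 'I_L -> R) (t : R) :
  abs_integrable h ->
  trig_poly K (spectrum T h a tau) (omega0 T) t =
  (\sum_(i < (2 * K).+1) \sum_(l < L) a l *
    (FT_re h ((i%:Z - K%:Z)%:~R * omega0 T) * cos ((i%:Z - K%:Z)%:~R * omega0 T * (t - tau l)) -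
     FT_im h ((i%:Z - K%:Z)%:~R * omega0 T) * sin ((i%:Z - K%:Z)%:~R * omega0 T * (t - tau l))))%:C.
Proof.
move=> hi; pose w := omega0 T.
pose B (k : int) := \sum_(l < L) a l *
  (FT_re h (k%:~R * w) * sin (k%:~R * w * (t - tau l)) +
   FT_im h (k%:~R * w) * cos (k%:~R * w * (t - tau l))).
have B0 : \sum_(i < (2 * K).+1) B (i%:Z - K%:Z) = 0.
  apply: sum_symmetric0 => k; rewrite /B -sumrN; apply: eq_bigr => l _.
  have -> : (- k)%:~R * w = - (k%:~R * w) by ring.
  by rewrite FT_reN FT_imN// [_ * (t - _)]mulNr sinN cosN; ring.
pose A (k : int) := \sum_(l < L) a l *
  (FT_re h (k%:~R * w) * cos (k%:~R * w * (t - tau l)) -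
   FT_im h (k%:~R * w) * sin (k%:~R * w * (t - tau l))).
transitivity (\sum_(i < (2 * K).+1) (A (i%:Z - K%:Z) +i* B (i%:Z - K%:Z))); last first.
  by rewrite sum_Complex B0.
apply: eq_bigr => i _; rewrite /A /B -sum_Complex /spectrum -/w.
rewrite -mulrA mulr_suml mulr_sumr.
apply: eq_bigr => l _; rewrite -mulrA -cisD.
set k : R := (i%:Z - K%:Z)%:~R.
have -> : - (k * w * tau l) + k * w * t = k * w * (t - tau l) by ring.
rewrite /FT /cis; apply/eqP; rewrite eq_complex /=; apply/andP.
by split; apply/eqP; ring.
Qed.

Lemma trig_polyB (K : nat) (c d : int -> R[i]) (w t : R) :
  trig_poly K (fun k => c k - d k) w t = trig_poly K c w t - trig_poly K d w t.
Proof. by rewrite /trig_poly -sumrB; apply: eq_bigr => i _; rewrite mulrBl. Qed.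

Lemma spectrum_inj (T : R) (L K : nat) (h : R -> R) (a tau a' tau' : 'I_L -> R) :
  0 < T ->
  (forall k : int, - (K%:Z) <= k <= K%:Z -> FT_nonzero h (k%:~R * omega0 T)) ->
  FRI_params T a tau -> FRI_params T a' tau' -> (L <= K)%N ->
  (forall i, (i <= 2 * K)%N ->
     spectrum T h a tau (i%:Z - K%:Z) = spectrum T h a' tau' (i%:Z - K%:Z)) ->
  exists s : 'I_L -> 'I_L, bijective s /\
    forall l, a' l = a (s l) /\ tau' l = tau (s l).
Proof.
move=> T0 hn [tb [ti _]] [tb' [ti' a0']] LK spec; pose w := omega0 T.
have w0 : 0 < w by exact: omega0_gt0.
have cti (u v : R) : 0 <= u < T -> 0 <= v < T ->
    cis (- (w * u)) = cis (- (w * v)) -> u = v.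
  move=> uT vT /cis_inj e; apply: (mulfI (lt0r_neq0 w0)); apply: oppr_inj; apply: e.
  rewrite -opprD normrN -mulrBr normrM gtr0_norm// -(omega0M T0) ltr_pM2l//.
  by rewrite ltr_norml; lra.
(* A phase absorbed in the amplitude shifts the frequencies [-K..K] to the exponents [0..2K] of a
   moment system. *)
pose A (b : 'I_L -> R) (t : 'I_L -> R) l : R[i] := (b l)%:C * cis (K%:R * (w * t l)).
have mom (b t : 'I_L -> R) (i : nat) : \sum_(l < L) A b t l * cis (- (w * t l)) ^+ i =
    \sum_(l < L) (b l)%:C * cis (- ((i%:Z - K%:Z)%:~R * w * t l)).
  by apply: eq_bigr => l _; rewrite /A -mulrA cisX -cisD; congr (_ * cis _); ring.
have dj : forall l, exists m, a' l = a m /\ tau' l = tau m.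
  move=> l.
  have [|||||m vm Am] := @moments_determine _ L (2 * K).+1 (A a tau) (A a' tau')
    (fun l => cis (- (w * tau l))) (fun l => cis (- (w * tau' l))) _ _ _ _ _ l.
  - by rewrite leqW// leq_mul2l.
  - by move=> m n /cti e; apply: ti; apply: e.
  - by move=> m n /cti e; apply: ti'; apply: e.
  - by move=> m; rewrite mulf_neq0 ?cis_neq0// eq_complex /= eqxx andbT.
  - move=> i iK; rewrite !mom; apply: (mulfI _ (spec i iK)).
    apply/negP => /eqP[h1 h2]; apply: (hn (i%:Z - K%:Z)); last by split.
    by move: iK; lia.
  exists m; have tt : tau' l = tau m by exact: cti vm.
  split => //; move: Am; rewrite /A tt => /(mulIf (cis_neq0 _)).
  exact: complexI.
have [s sP] := @choice _ _ (fun l m => a' l = a m /\ tau' l = tau m) dj.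
(* Indices with the same image under [s] share their [tau'], hence are equal; an injection of a
   finite set into itself is bijective. *)
exists s; split => //; apply: injF_bij => l m slm.
by apply: ti'; rewrite (sP l).2 (sP m).2 slm.
Qed.

End signal_spectrum.

(* Perfect recovery = identifiability: two admissible FRI signals (same known
   T, L, K, h, g, b, kappa, delta) whose IF-TEMs, started at the same time t0,
   have the same firing instants in [t0, t0+T] have the same parameters
   {(a_l, tau_l)} (up to relabelling of l). *)
Theorem theorem2 (R : realType) (T : R) (L K : nat) (h g : R -> R)
    (b kappa delta t0 : R)
    (a tau a' tau' : 'I_L -> R) (x y x' y' : R -> R) (c c' : R)
    (tn tn' : nat -> R) :
  0 < T ->
  (* pulse h: real, absolutely integrable, \hat h(k w0) <> 0 for |k| <= K *)
  abs_integrable h ->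
  (forall k : int, - (K%:Z) <= k <= K%:Z ->
     FT_nonzero h (k%:~R * omega0 T)) ->
  (* sampling kernel g *)
  abs_integrable g ->
  (forall k : int,
     FT_eq_real g (k%:~R * omega0 T)
       (if (- (K%:Z) <= k <= K%:Z) then 1 else 0)) ->
  (* max_t |(h * g)(t)| < oo *)
  conv_defined h g ->
  (exists M : R, forall t, `|convol h g t| <= M) ->
  (* IF-TEM parameters *)
  0 < b -> 0 < kappa -> 0 < delta ->
  (* first signal *)
  FRI_params T a tau ->
  FRI_signal T h a tau x ->
  conv_defined x g -> (forall t, y t = convol x g t) ->
  sup_abs y c -> c < b ->
  (b - c) / (kappa * delta) >= (2 * K%:R + 2) / T ->
  iftem_instants y b kappa delta t0 tn ->
  (* second signal *)
  FRI_params T a' tau' ->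
  FRI_signal T h a' tau' x' ->
  conv_defined x' g -> (forall t, y' t = convol x' g t) ->
  sup_abs y' c' -> c' < b ->
  (b - c') / (kappa * delta) >= (2 * K%:R + 2) / T ->
  iftem_instants y' b kappa delta t0 tn' ->
  (* K >= L *)
  (L <= K)%N ->
  (* same IF-TEM outputs *)
  same_instants_in t0 T tn tn' ->
  exists s : 'I_L -> 'I_L, bijective s /\
    forall l, a' l = a (s l) /\ tau' l = tau (s l).
Proof.
move=> T0 hi hn gi gK _ _ b0 kappa0 delta0.
move=> pa hx xgi yE [yb _] cb rate it pa' hx' xgi' yE' [yb' _] cb' rate' it' LK same.
pose w := omega0 T; have w0 : 0 < w by exact: omega0_gt0.
pose S (A t : 'I_L -> R) := spectrum T h A t.
(* This closed form supplies the continuity of [y] and [y'] on which the gap bound and Rolle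
   rely. *)
pose re (A t : 'I_L -> R) s := T^-1 * \sum_(i < (2 * K).+1) \sum_(l < L) A l *
    (FT_re h ((i%:Z - K%:Z)%:~R * w) * cos ((i%:Z - K%:Z)%:~R * w * (s - t l)) -
     FT_im h ((i%:Z - K%:Z)%:~R * w) * sin ((i%:Z - K%:Z)%:~R * w * (s - t l))).
have rec A t : continuous (re A t).
  have affc (k u : R) : continuous (fun s : R => k * (s - u)).
    move=> s; apply: cvgM; first exact: cvg_cst.
    by apply: cvgB => //; exact: cvg_cst.
  rewrite /re => s; apply: cvgM; first exact: cvg_cst.
  apply: continuous_sum_fct => i {}s; apply: continuous_sum_fct => l {}s.
  apply: cvgM; first exact: cvg_cst.
  apply: cvgB; (apply: cvgM; first exact: cvg_cst).
    by apply: continuous_comp; [exact: affc|exact: continuous_cos].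
  by apply: continuous_comp; [exact: affc|exact: continuous_sin].
have {yE}yE : y = re a tau.
  by apply/funext => t; rewrite yE (filtered_FRI_signal T0 t hi gi gK hx xgi).
have {yE'}yE' : y' = re a' tau'.
  by apply/funext => t; rewrite yE' (filtered_FRI_signal T0 t hi gi gK hx' xgi').
have yc : continuous y by rewrite yE.
have yc' : continuous y' by rewrite yE'.
(* The rate bounds each gap by [T / (2K + 2)], so the 2K+1 gaps ending at [tn (2K + 1)] fit in the
   window. *)
have gapT (d : R) : d < b -> (2 * K%:R + 2) / T <= (b - d) / (kappa * delta) ->
    (2 * K).+1%:R * (kappa * delta / (b - d)) <= T.
  move=> db rd; have bd : 0 < b - d by rewrite subr_gt0.
  have kd : 0 < kappa * delta by rewrite mulr_gt0.
  rewrite mulrA ler_pdivrMr//.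
  move: rd; rewrite ler_pdivlMr// mulrAC ler_pdivrMr// => rd.
  rewrite [leRHS]mulrC; apply: le_trans rd.
  by rewrite ler_pM2r// -natr1 natrM lerD2l ler1n.
have gap := iftem_gap kappa0 yc yb cb it.
have gap' := iftem_gap kappa0 yc' yb' cb' it'.
have [t00 itn] := it; have [t00' itn'] := it'.
have inc n : tn n < tn n.+1 by have [] := itn n.
have inc' n : tn' n < tn' n.+1 by have [] := itn' n.
have last_le : tn (2 * K).+1 <= t0 + T.
  by rewrite (le_trans (iftem_instant_le t00 gap _))// lerD2l gapT.
have last_le' : tn' (2 * K).+1 <= t0 + T.
  by rewrite (le_trans (iftem_instant_le t00' gap' _))// lerD2l gapT.
have tt := same_instants_eq inc inc' t00 t00' last_le last_le' same.
have zc : continuous (fun s => y s - y' s).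
  by move=> s; apply: continuousB; [exact: yc|exact: yc'].
(* On a common gap both integrals equal [kappa * delta], so [y - y'] integrates to 0. The
   existential stands outside the bound on [n] for [choice]; 0 is a dummy beyond [2K]. *)
have root n : exists s, (n <= 2 * K)%N -> tn n < s < tn n.+1 /\ y s - y' s = 0.
  case: (leqP n (2 * K)) => nK; last by exists 0.
  have [] := @Rintegral_eq0_root R _ _ _ (inc n) zc.
    have [_ [e _]] := itn n; have [_ [e' _]] := itn' n.
    move: e'; rewrite -!tt ?(leqW nK)// => e'.
    have yi := @continuous_integrable_itv R (fun s => y s + b) (tn n) (tn n.+1) _.
    have yi' := @continuous_integrable_itv R (fun s => y' s + b) (tn n) (tn n.+1) _.
    transitivity (Rintegral lebm `[tn n, tn n.+1] (fun s => (y s + b) - (y' s + b))).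
      by apply: eq_Rintegral => s _; ring.
    rewrite RintegralB//.
    - move: e; rewrite -e' => /(mulIf _) ->; first by rewrite subrr.
      by rewrite invr_neq0// gt_eqF.
    - by apply: yi => s; apply: continuousD; [exact: yc|exact: cvg_cst].
    - by apply: yi' => s; apply: continuousD; [exact: yc'|exact: cvg_cst].
  by move=> s sI s0; exists s.
have [s sP] := choice root.
have mon := increasing_lt inc.
(* Strictness at both ends keeps any two zeros less than a period apart, hence their phases less
   than one turn. *)
have sin n : (n <= 2 * K)%N -> t0 < s n < t0 + T.
  move=> nK; have [/andP[s1 s2] _] := sP n nK; apply/andP; split.
    by apply: le_lt_trans s1; rewrite -t00 leNgt mon.
  apply: lt_le_trans s2 _; apply: le_trans last_le; by rewrite leNgt mon -leqNgt ltnS.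
have slt m n : (m < n)%N -> (n <= 2 * K)%N -> s m < s n.
  move=> mn nK; have [/andP[_ s1] _] := sP m (leq_trans (ltnW mn) nK).
  have [/andP[s2 _] _] := sP n nK.
  by apply: lt_trans s1 (le_lt_trans _ s2); rewrite leNgt mon -leqNgt.
have coef0 i : (i <= 2 * K)%N -> S a tau (i%:Z - K%:Z) - S a' tau' (i%:Z - K%:Z) = 0.
  apply: (@trig_poly_eq0 R K (fun k => S a tau k - S a' tau' k) w s).
  - move=> m n mK nK; rewrite -mulrBr normrM gtr0_norm// -(omega0M T0) ltr_pM2l//.
    by have := sin m mK; have := sin n nK; rewrite ltr_norml; lra.
  - move=> m n mK nK /(mulfI (lt0r_neq0 w0)) smn.
    by case: (ltngtP m n) => // [/slt/(_ nK)|/slt/(_ mK)]; rewrite smn ltxx.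
  - move=> n nK; rewrite trig_polyB !signal_trig_poly// -rmorphB /=.
    have [_] := sP n nK; rewrite yE yE' -mulrBr => /eqP.
    by rewrite mulf_eq0 invr_eq0 (gt_eqF T0) /= => /eqP ->.
apply: (@spectrum_inj R T L K h) => // i iK.
by apply/eqP; rewrite -subr_eq0 coef0.
Qed.
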